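(* Let $\kappa$ be a kernel on a type space $(\mathcal S,\mu)$ and let $\lambda_c=\|T_\kappa\|^{-1}$. Then $\lambda\mapsto\chi(\lambda\kappa)=\hat\chi(\lambda\kappa)$ is an increasing, analytic function on $(0,\lambda_c)$, with a singularity at $\lambda_c$ (it is not analytic at $\lambda_c$). Furthermore, $\chi(\lambda\kappa)\uparrow\chi(\lambda_c\kappa)=\hat\chi(\lambda_c\kappa)\le\infty$ as $\lambda\uparrow\lambda_c$, and $\chi(\lambda\kappa;x)\uparrow\chi(\lambda_c\kappa;x)$ pointwise.
   Context: A type space is a measure space $(\mathcal S,\mu)$ with $0<\mu(\mathcal S)<\infty$; a kernel is a symmetric measurable $\kappa:\mathcal S^2\to[0,\infty)$ with $\int_{\mathcal S^2}\kappa<\infty$ and $\int\kappa(x,y)d\mu(y)<\infty$ for all $x$. $T_\kappa f(x)=\int\kappa(x,y)f(y)d\mu(y)$, $\|T_\kappa\|=\sup\{\|T_\kappa f\|_{L^2(\mu)}:f\ge0,\|f\|_{L^2(\mu)}\le1\}\in[0,\infty]$ (with $\lambda_c=0$ if $\|T_\kappa\|=\infty$). A function on the reals is analytic at a point if it equals a convergent power series in a neighbourhood of it. For a kernel $\kappa'$, the branching process $\mathfrak X_{\kappa'}(x)$ starts with one particle of type $x$; each particle of type $y$ independently has children whose types form a Poisson process with intensity $\kappa'(y,z)d\mu(z)$; $\chi(\kappa';x)=\mathbb E|\mathfrak X_{\kappa'}(x)|$, $\chi(\kappa')=\mu(\mathcal S)^{-1}\int\chi(\kappa';x)d\mu$,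 $\hat\chi(\kappa')=\mu(\mathcal S)^{-1}\int\mathbb E(|\mathfrak X_{\kappa'}(x)|;|\mathfrak X_{\kappa'}(x)|<\infty)d\mu(x)$. *)

(* Defs.v *)
From HB Require Import structures.
From mathcomp Require Import all_boot all_order all_algebra.
From mathcomp Require Import all_classical all_reals all_analysis.
Set Implicit Arguments. Unset Strict Implicit. Unset Printing Implicit Defensive.
Import Order.TTheory GRing.Theory Num.Theory.
Import numFieldNormedType.Exports.
Local Open Scope classical_set_scope.
Local Open Scope ring_scope.

Section Defs.
Context {d : measure_display} {T : measurableType d} {R : realType}.
Variable mu : {measure set T -> \bar R}.

Definition type_space : Prop := (0 < mu setT)%E /\ (mu setT < +oo)%E.

(* kernel: symmetric, measurable, nonnegative, integrable on S^2
   (double integral, = product integral by Tonelli), finite row integrals *)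
Definition is_kernel (k : T -> T -> R) : Prop :=
  [/\ (forall x y, 0 <= k x y),
      (forall x y, k x y = k y x),
      measurable_fun setT (fun p : T * T => k p.1 p.2),
      (\int[mu]_x \int[mu]_y (k x y)%:E < +oo)%E &
      (forall x, \int[mu]_y (k x y)%:E < +oo)%E].

Definition Top (k : T -> T -> R) (f : T -> R) (x : T) : \bar R :=
  \int[mu]_y (k x y * f y)%:E.

Definition Tnorm (k : T -> T -> R) : \bar R :=
  ereal_sup [set Lnorm mu 2%:E (Top k f) | f in
    [set f : T -> R | [/\ measurable_fun setT f, (forall x, 0 <= f x) &
                          (Lnorm mu 2%:E (EFin \o f) <= 1)%E]]].

Definition lambda_c (k : T -> T -> R) : \bar R :=
  let n := Tnorm k in
  if n == +oo%E then 0%E else if n == 0%E then +oo%E else ((fine n)^-1)%:E.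

Definition scale_kernel (l : R) (k : T -> T -> R) : T -> T -> R :=
  fun x y => l * k x y.

(* ---- The branching process X_k(x), generation by generation. ----
   A generation is a finite point configuration of types, represented by
   a sequence.  Given the current generation s, the next generation is a
   Poisson process with intensity rho_s(z) dmu(z), rho_s(z) = sum_{y in s} k(y,z),
   of finite total mass Lam_s = sum_{y in s} int k(y,z) dmu(z).  Its law is
   described through its Janossy densities: for F >= 0,
     E F(next) = e^{-Lam_s} sum_j 1/j! int...int F(z_1..z_j) prod rho_s(z_i) dmu^j. *)

Fixpoint iint (j : nat) (g : seq T -> \bar R) : \bar R :=
  match j with
  | 0 => g [::]
  | j'.+1 => (\int[mu]_z iint j' (fun zs => g (z :: zs)))%E
  end.

Definition rho (k : T -> T -> R) (s : seq T) (z : T) : R := \sum_(y <- s) k y z.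

Definition Lam (k : T -> T -> R) (s : seq T) : R :=
  fine (\sum_(y <- s) \int[mu]_z (k y z)%:E)%E.

Definition PoisE (k : T -> T -> R) (s : seq T) (F : seq T -> \bar R) : \bar R :=
  ((expR (- Lam k s))%:E *
   \sum_(0 <= j <oo) ((j`!%:R)^-1)%:E *
      iint j (fun zs => F zs * (\prod_(z <- zs) rho k s z)%:E))%E.

(* Mgen n s = E |G_n| when G_0 = s *)
Fixpoint Mgen (k : T -> T -> R) (n : nat) (s : seq T) : \bar R :=
  match n with
  | 0 => (size s)%:R%:E
  | n'.+1 => PoisE k s (Mgen k n')
  end.

(* Wext n s a = E[(a + sum_{i<=n} |G_i|) ; G_{n+1} = empty] when G_0 = s *)
Fixpoint Wext (k : T -> T -> R) (n : nat) (s : seq T) (a : nat) : \bar R :=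
  match n with
  | 0 => ((a + size s)%:R%:E * PoisE k s (fun zs => if zs is [::] then 1 else 0))%E
  | n'.+1 => PoisE k s (fun zs => Wext k n' zs (a + size s))
  end.

(* chi(k; x) = E |X_k(x)| = sum_n E |G_n| *)
Definition chi_pt (k : T -> T -> R) (x : T) : \bar R :=
  (\sum_(0 <= n <oo) Mgen k n [:: x])%E.

(* E(|X_k(x)| ; |X_k(x)| < oo): |X| < oo iff extinction, and the events
   {G_{n+1} = empty} increase to it, so this is sup_n Wext n [:: x] 0 *)
Definition chihat_pt (k : T -> T -> R) (x : T) : \bar R :=
  ereal_sup [set Wext k n [:: x] 0 | n in [set: nat]].

Definition chi (k : T -> T -> R) : \bar R :=
  (((fine (mu setT))^-1)%:E * \int[mu]_x chi_pt k x)%E.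

Definition chihat (k : T -> T -> R) : \bar R :=
  (((fine (mu setT))^-1)%:E * \int[mu]_x chihat_pt k x)%E.

End Defs.

Definition analytic_at_in {R : realType} (f : R -> R) (D : set R) (x0 : R) : Prop :=
  exists2 delta : R, 0 < delta &
  exists a : nat -> R, forall x, `|x - x0| < delta -> D x ->
    (fun N : nat => \sum_(0 <= n < N) a n * (x - x0) ^+ n) @ \oo --> f x.

(* Main.v *)
(** The expectation of an additive-multiplicative functional of a Poisson
process is explicit, so [E |G_n|] started at [x] is [T^n 1 (x)], whence
[chi (l k; x) = sum_n l^n T^n 1 (x)]: a power series in [l] with nonnegative
coefficients.  This gives monotonicity and the left limits at [lambda_c].

Extinction.  The survival probability [p] satisfies [p = 1 - exp (- T p) <= T p],
with equality only where [p = 0].  If [||T|| <= 1] then [||p||_2 <= ||T p||_2 <= ||p||_2],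
hence [p = 0] everywhere and [chihat = chi], also at [lambda_c].

Radius of convergence.  For [r > ||T||] one has [int T^n 1 <= r^n mu(S)], so the series
for [chi] converges on [(0, lambda_c)].  Conversely, if it converges at [y], then
[u = sum_n y^n T^n 1] is a.e. finite and [y T u <= u], so Schur's test gives
[||T|| <= 1 / y].  By Pringsheim's theorem (in a one-sided form, as analyticity at
[lambda_c] only concerns [l < lambda_c]), an analytic continuation at [lambda_c]
would force convergence at some [y > lambda_c], a contradiction. *)
Require Import Defs.
From HB Require Import structures.
From mathcomp Require Import all_boot all_order all_algebra.
From mathcomp Require Import all_classical all_reals all_analysis.
From mathcomp Require Import measurable_realfun ring lra.
Import Order.TTheory GRing.Theory Num.Theory.
Import numFieldNormedType.Exports.
Local Open Scope classical_set_scope.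
Local Open Scope ring_scope.
Set Implicit Arguments.
Unset Strict Implicit.
Unset Printing Implicit Defensive.

(** * Exponential series with extended real terms *)

Section series.
Context {R : realType}.

(** The functionals of a configuration that matter all have the form [(c + sum f) * prod g], and a
    Poisson expectation preserves this form: [f] becomes [T (f g)] and [g] becomes
    [exp (- T (1 - g))]. Generation sizes are the case [g = 1]; the population counted on extinction
    takes an extinction probability for [g]. No probability space is built, so [chi] and [chihat]
    cannot be compared event by event. Instead [U = chihat_pt] is shown to satisfy [1 + T U <= U],
    and therefore dominates every partial sum of [sum_n T^n 1]. The norm is a supremum over real
    functions, while [T f] may be infinite at some points; hence the passages to functions that are
    finite almost everywhere. An expansion at [lambda_c] represents [chi] only to the left of
    [lambda_c], so Taylor coefficients are compared at a centre further left, and the coefficient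
    identity uses only small positive increments. *)

Lemma nneseries_muleC (c : \bar R) (u : nat -> \bar R) : (0 <= c)%E ->
  (forall n, 0 <= u n)%E ->
  (\sum_(0 <= n <oo) (c * u n) = c * \sum_(0 <= n <oo) u n)%E.
Proof.
move=> c0 u0; rewrite -!ge0_integral_count//; last by move=> n; rewrite mule_ge0.
by rewrite ge0_integralZl.
Qed.

Lemma nneseries_EFin (u : nat -> R) (l : R) : (series u @ \oo --> l) ->
  (\sum_(0 <= n <oo) (u n)%:E = l%:E)%E.
Proof.
move=> ul; apply/cvg_lim => //=.
under eq_fun do rewrite sumEFin.
by apply: cvg_EFin; [exact: nearW|].
Qed.

Lemma nneseries_exp (x : R) :
  (\sum_(0 <= n <oo) ((n`!%:R)^-1 * x ^+ n)%:E = (expR x)%:E)%E.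
Proof.
apply: nneseries_EFin.
rewrite (_ : (fun n => _) = exp_coeff x); first exact: is_cvg_series_exp_coeff.
by apply/funext => n; rewrite /exp_coeff/= mulrC.
Qed.

Lemma nneseries_exp_shift (x : R) : 0 <= x ->
  (\sum_(0 <= n <oo) ((n`!%:R)^-1 * (n%:R * x ^+ n.-1))%:E = (expR x)%:E)%E.
Proof.
move=> x0; rewrite nneseries_recl//=; last first.
  by move=> n _; rewrite lee_fin !mulr_ge0 ?invr_ge0 ?exprn_ge0.
rewrite mul0r mulr0 add0e -(nneseries_addn 1); last first.
  by move=> n; rewrite lee_fin !mulr_ge0 ?invr_ge0 ?exprn_ge0.
rewrite -nneseries_exp; apply: eq_eseriesr => n _; congr EFin.
by rewrite addn1/= factS natrM invfM mulrACA mulVf ?mul1r// pnatr_eq0.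
Qed.

End series.

(** * Poisson expectations and the moments of a generation *)

Section branching.
Context {d : measure_display} {T : measurableType d} {R : realType}.
Variable mu : {measure set T -> \bar R}.
Local Open Scope ereal_scope.

(** Integrating out one point turns [c] into [c + f z] and [e] into [e * h z], so both must vary in
    the induction. Each of the [j] terms of the sum contributes one integral of [f h] and [j - 1]
    factors [B]. *)
Lemma iint_linear_prod (h : T -> R) (f : T -> \bar R) (B : R) :
  measurable_fun setT h -> (forall x, 0 <= h x)%R ->
  measurable_fun setT f -> (forall x, 0 <= f x) ->
  \int[mu]_x (h x)%:E = B%:E ->
  forall j (c : \bar R) (e : R), 0 <= c -> (0 <= e)%R ->
  iint mu j (fun zs => (c + \sum_(z <- zs) f z) * (e * \prod_(z <- zs) h z)%:E) =
  (c * (B ^+ j)%:E + (\int[mu]_x (f x * (h x)%:E)) * (j%:R * B ^+ j.-1)%:E) * e%:E.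
Proof.
move=> mh h0 mf f0 hB.
have B0 : (0 <= B)%R by rewrite -lee_fin -hB integral_ge0// => x _; rewrite lee_fin.
have [A EA A0] : exists2 A, \int[mu]_x (f x * (h x)%:E) = A & 0 <= A.
  by eexists; [reflexivity|rewrite integral_ge0// => x _; rewrite mule_ge0// lee_fin].
rewrite EA.
elim=> [|j IH] c e c0 e0.
  by rewrite /= !big_nil mulr1 mul0r expr0 mule0 mule1 adde0.
have b1 : (0 <= B ^+ j)%R by rewrite exprn_ge0.
have b2 : (0 <= j%:R * B ^+ j.-1)%R by rewrite mulr_ge0 ?exprn_ge0.
have E0 (a b : \bar R) (r : R) : 0 <= a -> 0 <= b -> (a + b) * r%:E = a * r%:E + b * r%:E.
  by move=> a0 b0; rewrite ge0_muleDl.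
rewrite /=.
transitivity (\int[mu]_z ((((c * (B ^+ j)%:E + A * (j%:R * B ^+ j.-1)%:E) * e%:E) * (h z)%:E)
    + ((B ^+ j)%:E * e%:E) * (f z * (h z)%:E))).
  apply: eq_integral => z _.
  under [X in iint mu j X]funext do rewrite !big_cons addeA mulrA.
  rewrite IH ?adde_ge0 ?mulr_ge0//.
  rewrite !(E0 c) ?E0 ?adde_ge0 ?mule_ge0 ?lee_fin//.
  rewrite EFinM !muleA -!addeA; congr (_ + _); rewrite addeC; congr (_ + _).
  by congr (_ * _); rewrite [RHS]muleC muleA.
rewrite ge0_integralD//; last 4 first.
  - move=> x _; rewrite mule_ge0 ?lee_fin// mule_ge0 ?lee_fin// adde_ge0 // mule_ge0 ?lee_fin//.
  - by apply: measurable_funeM; exact/measurable_EFinP.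
  - by move=> x _; rewrite !mule_ge0 ?lee_fin.
  - by apply: measurable_funeM; apply: emeasurable_funM => //; exact/measurable_EFinP.
rewrite ge0_integralZl//; last 3 first.
  - exact/measurable_EFinP.
  - by move=> x _; rewrite lee_fin.
  - by rewrite mule_ge0 ?lee_fin// adde_ge0 // mule_ge0 ?lee_fin.
rewrite ge0_integralZl//; last 3 first.
  - by apply: emeasurable_funM => //; exact/measurable_EFinP.
  - by move=> x _; rewrite mule_ge0 ?lee_fin.
  - by rewrite mule_ge0 ?lee_fin.
rewrite EA hB.
have -> : (j.+1%:R * B ^+ j = B ^+ j + (j%:R * B ^+ j.-1) * B)%R.
  by case: j {IH b1 b2} => [|j]; rewrite ?mul0r ?addr0 ?mul1r//= -natr1 exprS; ring.
rewrite [in RHS]EFinD ge0_muleDr ?lee_fin ?mulr_ge0 ?exprn_ge0//.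
rewrite !E0 ?adde_ge0 ?mule_ge0 ?lee_fin ?mulr_ge0 ?exprn_ge0//.
rewrite exprSr !EFinM !muleA -!addeA; congr (_ + _).
  by rewrite -!muleA; congr (_ * (_ * _)); rewrite muleC.
rewrite addeC; congr (_ + _); first by rewrite muleC -!muleA.
by rewrite -!muleA; do 3 congr (_ * _); rewrite muleC.
Qed.

(** The form of [Top] on extended real functions, which can be iterated even where its values are
    infinite. *)
Definition integral_operator (k : T -> T -> R) (f : T -> \bar R) (x : T) : \bar R :=
  \int[mu]_y ((k x y)%:E * f y).

Local Notation Tk := integral_operator.

Section fixed_kernel.
Variable k : T -> T -> R.
Hypotheses (k0 : forall x y, (0 <= k x y)%R)
  (mk : forall x, measurable_fun setT (k x))
  (kfin : forall x, \int[mu]_y (k x y)%:E < +oo).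

Lemma Tk_ge0 f x : (forall y, 0 <= f y) -> 0 <= Tk k f x.
Proof. by move=> f0; apply: integral_ge0 => y _; rewrite mule_ge0 ?lee_fin. Qed.

Lemma rho_ge0 s z : (0 <= rho k s z)%R.
Proof. by apply: sumr_ge0 => y _. Qed.

Lemma measurable_rho s : measurable_fun setT (rho k s).
Proof. by apply: measurable_sum => y. Qed.

Lemma integral_rho s (f : T -> \bar R) : measurable_fun setT f ->
  (forall x, 0 <= f x) ->
  \int[mu]_z (f z * (rho k s z)%:E) = \sum_(y <- s) Tk k f y.
Proof.
move=> mf f0; rewrite /Tk -ge0_integral_sum//.
- apply: eq_integral => z _; rewrite /rho -sumEFin ge0_sume_distrr//.
    by apply: eq_bigr => y _; rewrite muleC.
  by move=> y _; rewrite lee_fin.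
- by move=> y; apply: emeasurable_funM => //; exact/measurable_EFinP.
- by move=> y z _; rewrite mule_ge0 ?lee_fin.
Qed.

Lemma le_Tk f g : measurable_fun setT f -> measurable_fun setT g ->
  (forall x, 0 <= f x) -> (forall x, f x <= g x) -> forall x, Tk k f x <= Tk k g x.
Proof.
move=> mf mg f0 fg x; apply: ge0_le_integral => //.
- by move=> y _; rewrite mule_ge0 ?lee_fin.
- by apply: emeasurable_funM => //; exact/measurable_EFinP.
- by apply: emeasurable_funM => //; exact/measurable_EFinP.
- by move=> y _; rewrite lee_wpmul2l ?lee_fin.
Qed.

Lemma Tk_fin_num (g : T -> R) x : measurable_fun setT g -> (forall y, 0 <= g y <= 1)%R ->
  Tk k (EFin \o g) x \is a fin_num.
Proof.
move=> mg g01; rewrite ge0_fin_numE; last first.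
  by apply: Tk_ge0 => y; rewrite lee_fin; case/andP: (g01 y).
apply: le_lt_trans (kfin x).
apply: ge0_le_integral => //.
- by move=> y _; rewrite mule_ge0 ?lee_fin//; case/andP: (g01 y).
- by apply: emeasurable_funM; exact/measurable_EFinP.
- exact/measurable_EFinP.
- by move=> y _; rewrite -EFinM lee_fin ler_piMr//; case/andP: (g01 y).
Qed.

(** With [B] and [A] the integrals of [g] and [f g] against [rho k s], the sum over [j] is
    [(c + A) e^B]. Since the total mass [Lam] splits into the parts weighted by [g] and by [1 - g],
    the factor [e^(B - Lam)] is the stated product. The bound [g <= 1] and the finite row integrals
    keep [B] finite. *)
Lemma PoisE_linear_prod s (c : R) (f : T -> \bar R) (g : T -> R) : (0 <= c)%R ->
  measurable_fun setT f -> (forall x, 0 <= f x) ->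
  measurable_fun setT g -> (forall x, 0 <= g x <= 1)%R ->
  PoisE mu k s (fun zs => (c%:E + \sum_(z <- zs) f z) * (\prod_(z <- zs) g z)%:E) =
  (c%:E + \sum_(y <- s) Tk k (fun z => f z * (g z)%:E) y) *
  (\prod_(y <- s) expR (- fine (Tk k (fun z => (1 - g z)%:E) y)))%:E.
Proof.
move=> c0 mf f0 mg g01.
have g0 z : (0 <= g z)%R by case/andP: (g01 z).
have mcg : measurable_fun setT (fun z => 1 - g z)%R by exact: measurable_funB.
have cg01 z : (0 <= 1 - g z <= 1)%R by move: (g01 z); lra.
pose B := fine (\int[mu]_z (g z * rho k s z)%:E).
have sB : \int[mu]_z (g z * rho k s z)%:E = \sum_(y <- s) Tk k (EFin \o g) y.
  rewrite -integral_rho; first by apply: eq_integral => z _; rewrite EFinM.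
  - exact/measurable_EFinP.
  - by move=> z; rewrite lee_fin.
have EB : \int[mu]_z (g z * rho k s z)%:E = B%:E.
  rewrite fineK// sB; apply/sum_fin_numP => y _ _; exact: Tk_fin_num.
have B0 : (0 <= B)%R.
  by rewrite -lee_fin -EB integral_ge0// => x _; rewrite lee_fin mulr_ge0 ?rho_ge0.
pose A := \int[mu]_z (f z * (g z * rho k s z)%:E).
have A0 : 0 <= A.
  by rewrite integral_ge0// => x _; rewrite mule_ge0// lee_fin mulr_ge0 ?rho_ge0.
have EA : A = \sum_(y <- s) Tk k (fun z => f z * (g z)%:E) y.
  rewrite -integral_rho//.
  - by apply: eq_integral => z _; rewrite EFinM muleA.
  - by apply: emeasurable_funM => //; exact/measurable_EFinP.
  - by move=> z; rewrite mule_ge0// lee_fin.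
rewrite /PoisE.
transitivity ((expR (- Lam mu k s))%:E * ((c%:E + A) * (expR B)%:E)).
  congr (_ * _).
  have mgr : measurable_fun setT (fun z => g z * rho k s z)%R.
    by apply: measurable_funM => //; exact: measurable_rho.
  have gr0 z : (0 <= g z * rho k s z)%R by rewrite mulr_ge0 ?rho_ge0.
  transitivity (\sum_(0 <= j <oo) ((j`!%:R)^-1 * B ^+ j)%:E * c%:E +
     \sum_(0 <= j <oo) ((j`!%:R)^-1 * (j%:R * B ^+ j.-1))%:E * A).
    rewrite -nneseriesD; last 2 first.
    - by move=> j _ _; rewrite mule_ge0 ?lee_fin ?mulr_ge0 ?invr_ge0 ?exprn_ge0.
    - by move=> j _ _; rewrite mule_ge0 ?lee_fin ?mulr_ge0 ?invr_ge0 ?exprn_ge0.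
    apply: eq_eseriesr => j _.
    transitivity ((j`!%:R^-1)%:E *
        ((c%:E * (B ^+ j)%:E + A * (j%:R * B ^+ j.-1)%:E) * 1%:E)).
      rewrite -(iint_linear_prod mgr gr0 mf f0 EB)//; congr (_ * iint mu j _).
      by apply/funext => zs; rewrite -muleA -EFinM -big_split/= mul1r.
    rewrite mule1.
    rewrite ge0_muleDr ?mule_ge0 ?lee_fin ?mulr_ge0 ?exprn_ge0//.
    rewrite [in RHS]EFinM -muleA [c%:E * _]muleC; congr (_ + _).
    by rewrite [A * _]muleC muleA -EFinM.
  under eq_eseriesr do rewrite muleC.
  rewrite nneseries_muleC ?lee_fin//; last first.
    by move=> j; rewrite lee_fin ?mulr_ge0 ?invr_ge0 ?exprn_ge0.
  rewrite nneseries_exp.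
  under eq_eseriesr do rewrite muleC.
  rewrite nneseries_muleC//; last first.
    by move=> j; rewrite lee_fin ?mulr_ge0 ?invr_ge0 ?exprn_ge0.
  by rewrite nneseries_exp_shift// [in RHS]ge0_muleDl ?lee_fin.
rewrite muleCA -EFinM -expRD EA; congr (_ * (_)%:E).
rewrite -expR_sum; congr expR.
have Tk1 y : \int[mu]_z (k y z)%:E = Tk k (EFin \o g) y + Tk k (fun z => (1 - g z)%:E) y.
  rewrite /Tk -ge0_integralD//.
  - by apply: eq_integral => z _; rewrite /= -!EFinM -EFinD; congr EFin; ring.
  - by move=> z _; rewrite mule_ge0 ?lee_fin.
  - by apply: emeasurable_funM => //; exact/measurable_EFinP.
  - by move=> z _; rewrite mule_ge0 ?lee_fin//; case/andP: (cg01 z).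
  - by apply: emeasurable_funM => //; exact/measurable_EFinP.
have Tg y : Tk k (EFin \o g) y \is a fin_num by exact: Tk_fin_num.
have Tcg y : Tk k (fun z => (1 - g z)%:E) y \is a fin_num by exact: (@Tk_fin_num (fun z => 1 - g z)%R).
rewrite /Lam /B sB.
under eq_bigr do rewrite Tk1.
rewrite big_split/= fineD; last 2 first.
- exact/sum_fin_numP.
- exact/sum_fin_numP.
by rewrite sumrN sum_fine// opprD addrAC addNr add0r.
Qed.

End fixed_kernel.

(** * Closed forms for the generation means and for the size on extinction *)

Section kernel.
Variable k : T -> T -> R.
Hypotheses (fmu : mu setT < +oo) (K : is_kernel mu k).

Let k0 x y : (0 <= k x y)%R. Proof. by case: K. Qed.

Let mk x : measurable_fun setT (k x).
Proof. by case: K => _ _ mk _ _; exact: (measurable_fun_pair2 x mk). Qed.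

Let kfin x : \int[mu]_y (k x y)%:E < +oo. Proof. by case: K. Qed.

Lemma tonelli_finite (F : T * T -> \bar R) :
  measurable_fun setT F -> (forall p, 0 <= F p) ->
  measurable_fun setT (fun x => \int[mu]_y F (x, y)) /\
  \int[mu]_x \int[mu]_y F (x, y) = \int[mu]_y \int[mu]_x F (x, y).
Proof.
move=> mF F0.
(* Restricting [mu] to the whole space changes no value, but packages [fmu] as the finite-measure
   structure that Tonelli requires. *)
pose mu' : {finite_measure set T -> \bar R} := mfrestr measurableT fmu.
have -> : (mu : set T -> \bar R) = mu'.
  by apply/funext => A; rewrite /mu'/= /mfrestr /mrestr setIT.
split; first exact: (@measurable_fun_fubini_tonelli_F _ _ _ _ _ mu').
exact: (@fubini_tonelli _ _ _ _ _ mu' mu').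
Qed.

Lemma measurable_kernel_mul f : measurable_fun setT f ->
  measurable_fun setT (fun p : T * T => (k p.1 p.2)%:E * f p.2).
Proof.
move=> mf; apply: emeasurable_funM; last exact: measurableT_comp.
by apply/measurable_EFinP; case: K.
Qed.

Lemma measurable_Tk f : measurable_fun setT f -> (forall x, 0 <= f x) ->
  measurable_fun setT (Tk k f).
Proof.
move=> mf f0.
have F0 (p : T * T) : 0 <= (k p.1 p.2)%:E * f p.2 by rewrite mule_ge0 ?lee_fin.
by have [] := tonelli_finite (measurable_kernel_mul mf) F0.
Qed.

Lemma Tk_sym f g : measurable_fun setT f -> measurable_fun setT g ->
  (forall x, 0 <= f x) -> (forall x, 0 <= g x) ->
  \int[mu]_x (g x * Tk k f x) = \int[mu]_x (f x * Tk k g x).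
Proof.
move=> mf mg f0 g0.
transitivity (\int[mu]_x \int[mu]_y (g x * ((k x y)%:E * f y))).
  apply: eq_integral => x _; rewrite -ge0_integralZl//.
  - by apply: emeasurable_funM => //; exact/measurable_EFinP.
  - by move=> y _; rewrite mule_ge0 ?lee_fin.
pose F (p : T * T) := g p.1 * ((k p.1 p.2)%:E * f p.2).
have mF : measurable_fun setT F.
  by apply: emeasurable_funM; [exact: measurableT_comp|exact: measurable_kernel_mul].
have F0 p : 0 <= F p by rewrite !mule_ge0 ?lee_fin.
have [_ /= ->] := tonelli_finite mF F0.
apply: eq_integral => y _; rewrite -ge0_integralZl//.
- apply: eq_integral => x _; have -> : k y x = k x y by case: K.
  by rewrite muleA muleC; congr (_ * _); rewrite muleC.
- by apply: emeasurable_funM => //; exact/measurable_EFinP.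
- by move=> x _; rewrite mule_ge0 ?lee_fin.
Qed.

Lemma iter_Tk_ge0_measurable n :
  (forall x, 0 <= iter n (Tk k) (cst 1) x) /\
  measurable_fun setT (iter n (Tk k) (cst 1)).
Proof.
elim: n => [|n [IH1 IH2]]; first by split => // x; rewrite lee_fin.
by split; [move=> x; exact: Tk_ge0|exact: measurable_Tk].
Qed.

Lemma sum1_seq (s : seq T) : \sum_(y <- s) 1 = (size s)%:R%:E :> \bar R.
Proof.
elim: s => [|y s IH]; first by rewrite big_nil.
by rewrite big_cons IH -EFinD nat1r.
Qed.

(** The case [c = 0], [g = 1] of [PoisE_linear_prod]: the exponents vanish and each generation
    applies [T] once. *)
Lemma Mgen_iter n s : Mgen mu k n s = \sum_(y <- s) iter n (Tk k) (cst 1) y.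
Proof.
elim: n s => [s|n IH s] /=.
  by rewrite sum1_seq.
have [f0 mf] := iter_Tk_ge0_measurable n.
transitivity (PoisE mu k s (fun zs =>
    (0%:E + \sum_(z <- zs) iter n (Tk k) (cst 1) z) * (\prod_(z <- zs) 1)%:E)).
  by congr PoisE; apply/funext => zs; rewrite IH big1_eq mule1 add0e.
rewrite (PoisE_linear_prod k0 mk kfin s (lexx _) mf f0 (g := cst 1%R))//; last first.
  by move=> x; rewrite /= ler01 lexx.
rewrite add0e.
rewrite [X in _ * X%:E]big1 ?mule1.
  by apply: eq_bigr => y _; apply: eq_integral => z _; rewrite mule1.
move=> y _; rewrite /Tk integral0_eq ?oppr0 ?expR0// => z _.
by rewrite subrr mule0.
Qed.

(* [surv n x] is the probability that generation [n] is nonempty when [G_0 = [:: x]]. *)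
Fixpoint surv n (x : T) : R :=
  if n is n'.+1 then (1 - expR (- fine (Tk k (EFin \o surv n') x)))%R else 1%R.

Lemma surv_measurable01 n :
  measurable_fun setT (surv n) /\ (forall x, (0 <= surv n x <= 1)%R).
Proof.
elim: n => [|n [mp p01]] /=; first by split => // _; rewrite ler01 lexx.
have p0 x : (0 <= surv n x)%R by case/andP: (p01 x).
split.
  apply: measurable_funB => //; apply: measurableT_comp => //.
  apply: measurableT_comp => //; apply: measurableT_comp => //.
  by apply: measurable_Tk => [|x]; [exact/measurable_EFinP|rewrite lee_fin].
move=> x; rewrite subr_ge0 gerBl expR_ge0 andbT.
by rewrite -expR0 ler_expR oppr_le0 fine_ge0// Tk_ge0// => y; rewrite lee_fin.
Qed.

(* [wext n x * (1 - surv n.+1 x)] is [E (|G_0| + ... + |G_n| ; G_{n+1} = empty)]. *)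
Fixpoint wext n (x : T) : \bar R :=
  if n is n'.+1
  then 1 + Tk k (fun z => wext n' z * (1 - surv n'.+1 z)%:E) x else 1.

Lemma wext_ge0_measurable n : (forall x, 0 <= wext n x) /\ measurable_fun setT (wext n).
Proof.
elim: n => [|n [w0 mw]]; first by split; [move=> x; exact: lee01|exact: measurable_cst].
have [mp p01] := surv_measurable01 n.+1.
have u0 z : 0 <= wext n z * (1 - surv n.+1 z)%:E.
  by rewrite mule_ge0// lee_fin subr_ge0; case/andP: (p01 z).
split; first by move=> x; rewrite /= adde_ge0// Tk_ge0.
apply: emeasurable_funD => //; apply: measurable_Tk => //.
by apply: emeasurable_funM => //; apply/measurable_EFinP; apply: measurable_funB.
Qed.

(** Extinction is a product over the particles and the accumulated population is a sum, so the
    recursion stays within the scope of [PoisE_linear_prod], with [c] the population counted so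
    far. *)
Lemma Wext_wext n s a : Wext mu k n s a =
  (a%:R%:E + \sum_(y <- s) wext n y) * (\prod_(y <- s) (1 - surv n.+1 y))%:E.
Proof.
have surv1 y : (1 - surv 1 y = expR (- fine (Tk k (fun=> 1%E) y)))%R.
  by rewrite /= subKr.
elim: n s a => [|n IH] s a.
  rewrite /Wext.
  (* The indicator of the empty configuration is the product with [g = 0], an empty product being
     1. *)
  transitivity ((a + size s)%:R%:E * PoisE mu k s (fun zs =>
    (1%:E + \sum_(z <- zs) (cst 0 : T -> \bar R) z) * (\prod_(z <- zs) 0)%:E)).
    congr (_ * PoisE _ _ _ _); apply/funext => -[|z zs].
      by rewrite !big_nil adde0 mule1.
    by rewrite !big_cons mul0r mule0.
  rewrite (PoisE_linear_prod k0 mk kfin s ler01 _ _ (g := cst 0%R))//; last first.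
    by move=> x; rewrite /= lexx ler01.
  rewrite muleA; congr (_ * _).
    rewrite big1 ?adde0 ?mule1; last first.
      by move=> y _; rewrite /Tk integral0_eq// => z _; rewrite mul0e mule0.
    by rewrite natrD EFinD; congr (_ + _); rewrite sum1_seq.
  congr EFin; apply: eq_bigr => y _; rewrite surv1.
  by under eq_fun do rewrite /= subr0.
have [w0 mw] := wext_ge0_measurable n.
have [mp p01] := surv_measurable01 n.+1.
transitivity (PoisE mu k s (fun zs =>
    ((a + size s)%:R%:E + \sum_(z <- zs) wext n z) * (\prod_(z <- zs) (1 - surv n.+1 z))%:E)).
  by congr PoisE; apply/funext => zs; rewrite -IH.
rewrite (PoisE_linear_prod k0 mk kfin s _ mw w0 (g := fun z => (1 - surv n.+1 z)%R))//; last 2 first.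
- exact: measurable_funB.
- by move=> z; move: (p01 z); lra.
congr (_ * _).
  rewrite natrD EFinD -addeA; congr (_ + _).
  by rewrite -sum1_seq -big_split.
congr EFin; apply: eq_bigr => y _; rewrite [in RHS]/= subKr.
by do 4 f_equal; apply/funext => z /=; rewrite subKr.
Qed.

End kernel.
End branching.

(** * Extinction *)

Section extinction.
Context {d : measure_display} {T : measurableType d} {R : realType}.
Variable mu : {measure set T -> \bar R}.
Variable k : T -> T -> R.
Local Open Scope ereal_scope.
Hypotheses (fmu : mu setT < +oo) (K : is_kernel mu k).

Let k0 x y : (0 <= k x y)%R. Proof. by case: K. Qed.

Let mk x : measurable_fun setT (k x).
Proof. by case: K => _ _ mk _ _; exact: (measurable_fun_pair2 x mk). Qed.

Let kfin x : \int[mu]_y (k x y)%:E < +oo. Proof. by case: K. Qed.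

Local Notation Tk := (integral_operator mu k).
Local Notation surv := (surv mu k).
Local Notation wext := (wext mu k).

Definition Tsum n (x : T) : \bar R := \sum_(0 <= i < n) iter i Tk (cst 1) x.

Lemma Tsum_ge0_measurable n : (forall x, 0 <= Tsum n x) /\ measurable_fun setT (Tsum n).
Proof.
split; first by move=> x; apply: sume_ge0 => i _; have [] := iter_Tk_ge0_measurable fmu K i.
by apply: emeasurable_sum => i; have [] := iter_Tk_ge0_measurable fmu K i.
Qed.

(** The same first-generation recursion as [wextS], without the extinction factors; this is what
    makes the two sequences comparable. *)
Lemma TsumS n x : Tsum n.+1 x = 1 + Tk (Tsum n) x.
Proof.
rewrite /Tsum big_nat_recl//=; congr (_ + _).
rewrite /Tk -ge0_integral_sum//.
- apply: eq_integral => y _; rewrite ge0_sume_distrr// => i _.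
  by have [] := iter_Tk_ge0_measurable fmu K i.
- move=> i; have [_ ?] := iter_Tk_ge0_measurable fmu K i.
  by apply: emeasurable_funM => //; exact/measurable_EFinP.
- by move=> i y _; have [? _] := iter_Tk_ge0_measurable fmu K i; rewrite mule_ge0 ?lee_fin.
Qed.

Lemma chi_ptE x : chi_pt mu k x = \sum_(0 <= i <oo) iter i Tk (cst 1) x.
Proof. by apply: eq_eseriesr => n _; rewrite (Mgen_iter fmu K) big_seq1. Qed.

Lemma Tsum_le_chi_pt n x : Tsum n x <= chi_pt mu k x.
Proof.
rewrite chi_ptE; apply: nneseries_lim_ge => i _ _.
by have [] := iter_Tk_ge0_measurable fmu K i.
Qed.

Lemma surv_nonincreasing n x : (surv n.+1 x <= surv n x)%R.
Proof.
elim: n x => [|n IH] x.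
  by have [_ /(_ x)/andP[]] := surv_measurable01 fmu K 1.
have [mp p01] := surv_measurable01 fmu K n.
have [mq q01] := surv_measurable01 fmu K n.+1.
rewrite /= lerD2l lerN2 ler_expR lerN2.
apply: fine_le; [exact: (@Tk_fin_num _ _ _ mu k)..|].
apply: le_Tk => //; [exact/measurable_EFinP|exact/measurable_EFinP|move=> y].
by rewrite lee_fin; case/andP: (q01 y).
Qed.

Definition ext_weight n x := wext n x * (1 - surv n.+1 x)%:E.

Lemma Wext_ext_weight n x : Wext mu k n [:: x] 0 = ext_weight n x.
Proof. by rewrite (Wext_wext fmu K) !big_seq1 add0e. Qed.

Lemma ext_weight_ge0_measurable n :
  (forall x, 0 <= ext_weight n x) /\ measurable_fun setT (ext_weight n).
Proof.
have [w0 mw] := wext_ge0_measurable fmu K n.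
have [mp p01] := surv_measurable01 fmu K n.+1.
split; first by move=> x; rewrite mule_ge0// lee_fin subr_ge0; case/andP: (p01 x).
by apply: emeasurable_funM => //; apply/measurable_EFinP; exact: measurable_funB.
Qed.

Lemma ext_weight_le_wext n x : ext_weight n x <= wext n x.
Proof.
have [w0 _] := wext_ge0_measurable fmu K n.
have [_ /(_ x) p01] := surv_measurable01 fmu K n.+1.
by rewrite /ext_weight -[leRHS]mule1 lee_wpmul2l// lee_fin; lra.
Qed.

Lemma wextS n x : wext n.+1 x = 1 + Tk (ext_weight n) x.
Proof. by []. Qed.

Lemma wext_nondecreasing n x : wext n x <= wext n.+1 x.
Proof.
elim: n x => [|n IH] x.
  by rewrite wextS leeDl// Tk_ge0//; have [] := ext_weight_ge0_measurable 0.
have [u0 mu0] := ext_weight_ge0_measurable n.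
have [u1 mu1] := ext_weight_ge0_measurable n.+1.
have [w0 _] := wext_ge0_measurable fmu K n.
rewrite (wextS n) (wextS n.+1); apply: leeD2l; apply: (le_Tk mu k0 mk mu0 mu1 u0) => y.
have [_ /(_ y) p01] := surv_measurable01 fmu K n.+1.
apply: lee_pmul => //; first by rewrite lee_fin; lra.
by rewrite lee_fin; have := surv_nonincreasing n.+1 y; lra.
Qed.

Lemma ext_weight_nondecreasing x : {homo ext_weight^~ x : m n / (m <= n)%N >-> m <= n}.
Proof.
apply/nondecreasing_seqP => n.
have [w0 _] := wext_ge0_measurable fmu K n.
have [_ /(_ x) p01] := surv_measurable01 fmu K n.+1.
apply: lee_pmul => //; [by rewrite lee_fin; lra|exact: wext_nondecreasing|].
by rewrite lee_fin; have := surv_nonincreasing n.+1 x; lra.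
Qed.

(** Dropping the extinction factors, which are at most 1, turns the recursion of [wext] into that of
    [Tsum]. *)
Lemma wext_le_Tsum n x : wext n x <= Tsum n.+1 x.
Proof.
elim: n x => [|n IH] x; first by rewrite /Tsum big_nat1.
have [u0 mu0] := ext_weight_ge0_measurable n.
have [s0 ms] := Tsum_ge0_measurable n.+1.
rewrite wextS TsumS; apply: leeD2l; apply: (le_Tk mu k0 mk mu0 ms u0) => y.
exact: le_trans (ext_weight_le_wext n y) _.
Qed.

Lemma chihat_pt_le x : chihat_pt mu k x <= chi_pt mu k x.
Proof.
apply: ge_ereal_sup => _ [n _ <-]; rewrite Wext_ext_weight.
apply: le_trans (ext_weight_le_wext n x) _.
exact: le_trans (wext_le_Tsum n x) (Tsum_le_chi_pt _ _).
Qed.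

(* [1 - e^{-t} < t] for [t > 0], so a nonzero survival probability [p = 1 - e^{-Tp}]
   would give [||p||_2 < ||Tp||_2], against the contraction hypothesis. *)
Lemma surv_cvg0 :
  (forall f : T -> R, measurable_fun setT f -> (forall x, 0 <= f x)%R ->
    \int[mu]_x (Tk (EFin \o f) x * Tk (EFin \o f) x) <= \int[mu]_x (f x * f x)%:E) ->
  forall x, surv n x @[n --> \oo] --> 0%R.
Proof.
move=> contr.
have mono x : {homo surv^~ x : m n / (m <= n)%N >-> (n <= m)%R}.
  by apply/nonincreasing_seqP => n; exact: surv_nonincreasing.
have s01 n x : (0 <= surv n x <= 1)%R by have [] := surv_measurable01 fmu K n.
have cs x : cvgn (surv^~ x).
  apply: nonincreasing_is_cvgn => //; exists 0%R => _ [n _ <-].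
  by case/andP: (s01 n x).
pose p x : R := limn (surv^~ x).
have sp x : surv n x @[n --> \oo] --> p x by exact: cs.
have p0 x : (0 <= p x)%R by apply: limr_ge => //; apply: nearW => n; case/andP: (s01 n x).
have p1 x : (p x <= 1)%R by apply: limr_le => //; apply: nearW => n; case/andP: (s01 n x).
have p01 x : (0 <= p x <= 1)%R by rewrite p0 p1.
have mp : measurable_fun setT p.
  by apply: (@measurable_fun_cvg _ _ _ _ surv) => // n; have [] := surv_measurable01 fmu K n.
have finp x : Tk (EFin \o p) x \is a fin_num by exact: (@Tk_fin_num _ _ _ mu k).
(* The recursion of [surv] passes to the limit by dominated convergence, with the integrable row
   [k x] as dominating function. *)
have pE x : p x = (1 - expR (- fine (Tk (EFin \o p) x)))%R.
  have psx : [sequence surv n.+1 x]_n @ \oo --> p x by rewrite (cvg_shiftS (surv^~ x)).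
  apply: (@cvg_unique _ (@Rhausdorff R) _ _ _ _ psx).
  apply: (@cvgB _ R^o _ _ _ (fun=> 1%R) (fun n => expR (- fine (Tk (EFin \o surv n) x)))).
    exact: cvg_cst.
  apply: (@continuous_cvg _ _ _ _ _ _ expR); first exact: continuous_expR.
  apply: (@cvgN _ R^o); apply: fine_cvg; rewrite fineK//.
  pose F n y := (k x y)%:E * (surv n y)%:E.
  have mF n : measurable_fun setT (F n).
    apply: emeasurable_funM; apply/measurable_EFinP => //.
    by have [] := surv_measurable01 fmu K n.
  have mkp : measurable_fun setT (fun y => (k x y)%:E * (p y)%:E).
    by apply: emeasurable_funM; exact/measurable_EFinP.
  have Fcvg : {ae mu, forall y, setT y -> F n y @[n --> \oo] --> (k x y)%:E * (p y)%:E}.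
    apply: aeW => y _; apply: cvgeZl => //; apply: cvg_EFin; [exact: nearW|exact: sp].
  have kint : mu.-integrable setT (fun y => (k x y)%:E).
    apply/integrableP; split; first exact/measurable_EFinP.
    by under eq_integral do rewrite gee0_abs ?lee_fin//.
  have Fk : {ae mu, forall y n, setT y -> `|F n y| <= (k x y)%:E}.
    apply: aeW => y n _; case/andP: (s01 n y) => ? ?.
    by rewrite /F -EFinM gee0_abs ?lee_fin ?mulr_ge0// ler_piMr.
  by have [] := dominated_convergence measurableT mF mkp Fcvg kint Fk.
pose t x := fine (Tk (EFin \o p) x).
have t0 x : (0 <= t x)%R by rewrite fine_ge0// Tk_ge0.
have mt : measurable_fun setT t.
  by apply: measurableT_comp => //; apply: measurable_Tk => //; exact/measurable_EFinP.
have pt x : (p x <= t x)%R by rewrite pE -/(t x); have := expR_ge1Dx (- t x); lra.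
(* This finiteness allows the integral of [p^2] to be cancelled when the contraction hypothesis is
   used to show that [t^2 - p^2] has integral 0. *)
have pp_fin : \int[mu]_x (p x * p x)%:E < +oo.
  apply: (@le_lt_trans _ _ (\int[mu]_x (cst 1%:E x))).
    apply: ge0_le_integral => //.
    - by move=> x _; rewrite lee_fin mulr_ge0.
    - by apply/measurable_EFinP; exact: measurable_funM.
    - by move=> x _; rewrite lee_fin mulr_ile1.
  by rewrite integral_cst// mul1e.
pose D x := (t x * t x - p x * p x)%R.
have D0 x : (0 <= D x)%R by rewrite subr_ge0 ler_pM.
have mD : measurable_fun setT D by apply: measurable_funB; exact: measurable_funM.
have intD : \int[mu]_x `|(D x)%:E| = 0.
  under eq_integral do rewrite gee0_abs ?lee_fin//.
  apply/eqP; rewrite eq_le integral_ge0 ?andbT//; last by move=> x _; rewrite lee_fin.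
  rewrite -(@leeD2lE _ (\int[mu]_x (p x * p x)%:E)); last first.
    by rewrite ge0_fin_numE// integral_ge0// => x _; rewrite lee_fin mulr_ge0.
  rewrite adde0 -ge0_integralD//.
  - apply: le_trans (contr p mp p0).
    rewrite le_eqVlt; apply/orP; left; apply/eqP; apply: eq_integral => x _.
    by rewrite -EFinD addrC subrK -(fineK (finp x)) EFinM.
  - by move=> x _; rewrite lee_fin mulr_ge0.
  - by apply/measurable_EFinP; exact: measurable_funM.
  - by move=> x _; rewrite lee_fin.
  - exact/measurable_EFinP.
have [/(_ intD) aeD _] := @ae_eq_integral_abs _ _ _ mu setT measurableT (EFin \o D) ltac:(exact/measurable_EFinP).
(* Almost everywhere [t = p], which with [p = 1 - e^{-t}] forces [t = 0]. So [p] vanishes almost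
   everywhere, which gives [T p = 0] at every point, and [pE] then gives [p = 0] at every point. *)
have Tp0 x : Tk (EFin \o p) x = 0.
  rewrite /Tk (@ge0_ae_eq_integral _ _ _ mu setT _ (cst 0)) ?integral0//.
  - by apply: emeasurable_funM; exact/measurable_EFinP.
  - by move=> y _; rewrite mule_ge0 ?lee_fin.
  - apply: filterS aeD => y /(_ I) /= [Dy] _.
    have pty : p y = t y.
      have : (t y * t y - p y * p y = (t y - p y) * (t y + p y))%R by ring.
      rewrite -/(D y) Dy => /esym/eqP; rewrite mulf_eq0 => /orP[/eqP|/eqP].
        by move/subr0_eq.
      have := p0 y; have := pt y; lra.
    have ty0 : t y = 0%R.
      apply/eqP; apply/negPn/negP => tn0.
      have := pE y; rewrite -/(t y) pty => tE.
      have : (- t y)%R != 0%R by rewrite oppr_eq0.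
      move=> /expR_gt1Dx; lra.
    by rewrite pty ty0 mule0.
move=> x; have := sp x; rewrite (pE x) Tp0 /= oppr0 expR0 subrr.
exact.
Qed.

(** Once extinction is almost sure, the factors [1 - surv] tend to 1, so [U = chihat_pt] bounds
    [wext] itself and not only [ext_weight]. The recursion of [wext] then gives [1 + T U <= U], and
    induction gives [Tsum m <= U]. *)
Lemma chi_pt_chihat_pt :
  (forall f : T -> R, measurable_fun setT f -> (forall x, 0 <= f x)%R ->
    \int[mu]_x (Tk (EFin \o f) x * Tk (EFin \o f) x) <= \int[mu]_x (f x * f x)%:E) ->
  forall x, chi_pt mu k x = chihat_pt mu k x.
Proof.
move=> /surv_cvg0 s0 x; apply/eqP; rewrite eq_le chihat_pt_le andbT.
pose U := chihat_pt mu k.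
have uU n y : ext_weight n y <= U y.
  by apply: ereal_sup_ubound; exists n => //; exact: Wext_ext_weight.
have u_cvg y : ext_weight n y @[n --> \oo] --> U y.
  have -> : U y = ereal_sup (range (ext_weight^~ y)).
    by congr ereal_sup; apply: eq_imagel => n _; rewrite Wext_ext_weight.
  by apply: ereal_nondecreasing_cvgn; exact: ext_weight_nondecreasing.
have U0 y : 0 <= U y.
  by apply: le_trans (uU 0%N y); have [] := ext_weight_ge0_measurable 0.
have mU : measurable_fun setT U.
  by apply: (emeasurable_fun_cvg ext_weight) => // n; have [] := ext_weight_ge0_measurable n.
(* It is enough to bound [r * wext n y] for each [r < 1]. An index [m >= n] with extinction
   probability at least [r] does this, as [wext] is nondecreasing in its index. *)
have wU n y : wext n y <= U y.
  have [w0 _] := wext_ge0_measurable fmu K n.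
  apply/lee_mul01Pr => // r /andP[r0 r1].
  have r1' : (0 < 1 - r)%R by lra.
  have /cvgr_dist_lt/(_ _ r1')[N _ NP] := s0 y.
  pose m := maxn n N.
  have := NP m.+1 (leqW (leq_maxr _ _)); rewrite /= sub0r normrN => sm.
  have {}sm : (r <= 1 - surv m.+1 y)%R by have := ler_norm (surv m.+1 y); lra.
  apply: le_trans (uU m y); rewrite muleC; apply: lee_pmul => //; first by rewrite lee_fin ltW.
  have : {homo wext^~ y : m n / (m <= n)%N >-> m <= n}.
    by apply/nondecreasing_seqP => i; exact: wext_nondecreasing.
  by apply; exact: leq_maxl.
(* Monotone convergence in [wext n.+1 = 1 + T (ext_weight n)], whose left side is at most [U] by
   [wU]. *)
have TU y : 1 + Tk U y <= U y.
  rewrite -leeBrDl//.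
  have <- : limn (fun n => Tk (ext_weight n) y) = Tk U y.
    apply/cvg_lim => //.
    have -> : Tk U y = \int[mu]_z limn (fun n => (k y z)%:E * ext_weight n z).
      apply: eq_integral => z _; apply/esym/cvg_lim => //.
      by apply: cvgeZl.
    apply: cvg_monotone_convergence => //.
    - move=> n; have [_ ?] := ext_weight_ge0_measurable n.
      by apply: emeasurable_funM => //; exact/measurable_EFinP.
    - by move=> n z _; have [? _] := ext_weight_ge0_measurable n; rewrite mule_ge0 ?lee_fin.
    - by move=> z _ m n mn; rewrite lee_wpmul2l ?lee_fin//; exact: ext_weight_nondecreasing.
  apply: lime_le; last by apply: nearW => n; rewrite leeBrDl// -wextS.
  apply: ereal_nondecreasing_is_cvgn => m n mn.
  have [? ?] := ext_weight_ge0_measurable m.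
  have [? ?] := ext_weight_ge0_measurable n.
  by apply: (le_Tk mu k0 mk) => // z; exact: ext_weight_nondecreasing.
have TsumU m y : Tsum m y <= U y.
  elim: m y => [|m IH] y; first by rewrite /Tsum big_nil.
  have [? ?] := Tsum_ge0_measurable m.
  by rewrite TsumS; apply: le_trans (TU y); apply: leeD2l; apply: (le_Tk mu k0 mk).
rewrite chi_ptE; apply: lime_le; last by apply: nearW => n; exact: TsumU.
apply: is_cvg_nneseries => n _ _.
by have [] := iter_Tk_ge0_measurable fmu K n.
Qed.

End extinction.

(** * Norm bounds and Schur's test *)

Section L2.
Context {d : measure_display} {T : measurableType d} {R : realType}.
Variable mu : {measure set T -> \bar R}.
Variable k : T -> T -> R.
Local Open Scope ereal_scope.
Hypotheses (fmu : mu setT < +oo) (K : is_kernel mu k).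

Let k0 x y : (0 <= k x y)%R. Proof. by case: K. Qed.

Let mk x : measurable_fun setT (k x).
Proof. by case: K => _ _ mk _ _; exact: (measurable_fun_pair2 x mk). Qed.

Local Notation Tk := (integral_operator mu k).
Local Notation Tone := (fun n => iter n Tk (cst 1)).

Lemma poweR2 (x : \bar R) : 0 <= x -> x `^ 2 = x * x.
Proof.
case: x => [x|_|//]; last by rewrite poweRE pnatr_eq0/= mulyy.
by rewrite lee_fin => x0; rewrite poweR_EFin powR_mulrn.
Qed.

Lemma Lnorm2_sq (g : T -> \bar R) : (forall x, 0 <= g x) ->
  Lnorm mu 2%:E g * Lnorm mu 2%:E g = \int[mu]_x (g x * g x).
Proof.
move=> g0; rewrite -poweR2 ?Lnorm_ge0// poweR_Lnorm ?pnatr_eq0//.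
by apply: eq_integral => x _; rewrite gee0_abs// poweR2.
Qed.

Lemma lee_sqr_EFin (x : \bar R) (r : R) : 0 <= x -> (0 <= r)%R ->
  (x * x <= (r * r)%:E) = (x <= r%:E).
Proof.
case: x => [x|_ _|//]; last by rewrite mulyy !leye_eq.
by rewrite -EFinM !lee_fin => x0 r0; rewrite -!expr2 ler_sqr ?nnegrE.
Qed.

Lemma Lnorm2_le (g : T -> \bar R) (r : R) : (forall x, 0 <= g x) -> (0 <= r)%R ->
  (Lnorm mu 2%:E g <= r%:E) = (\int[mu]_x (g x * g x) <= (r * r)%:E).
Proof. by move=> g0 r0; rewrite -Lnorm2_sq// lee_sqr_EFin ?Lnorm_ge0. Qed.

Lemma TopE (f : T -> R) : Top mu k f = Tk (EFin \o f).
Proof. by []. Qed.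

Lemma TkZ (c : R) (f : T -> \bar R) x : (0 <= c)%R -> measurable_fun setT f ->
  (forall y, 0 <= f y) -> Tk (fun y => c%:E * f y) x = c%:E * Tk f x.
Proof.
move=> c0 mf f0; rewrite /Tk -ge0_integralZl//.
- by apply: eq_integral => y _; rewrite muleCA.
- by apply: emeasurable_funM => //; exact/measurable_EFinP.
- by move=> y _; rewrite mule_ge0 ?lee_fin.
Qed.

Lemma Tk_ae_eq f g x : measurable_fun setT f -> measurable_fun setT g ->
  (forall y, 0 <= f y) -> (forall y, 0 <= g y) ->
  {ae mu, forall y, f y = g y} -> Tk f x = Tk g x.
Proof.
move=> mf mg f0 g0 fg; apply: ge0_ae_eq_integral => //.
- by apply: emeasurable_funM => //; exact/measurable_EFinP.
- by apply: emeasurable_funM => //; exact/measurable_EFinP.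
- by move=> y _; rewrite mule_ge0 ?lee_fin.
- by move=> y _; rewrite mule_ge0 ?lee_fin.
- by apply: filterS fg => y fgy _; rewrite fgy.
Qed.

Lemma Tnorm_le (r : R) : (0 <= r)%R ->
  (forall f : T -> R, measurable_fun setT f -> (forall x, 0 <= f x)%R ->
    \int[mu]_x (f x * f x)%:E <= 1 ->
    \int[mu]_x (Tk (EFin \o f) x * Tk (EFin \o f) x) <= (r * r)%:E) ->
  Tnorm mu k <= r%:E.
Proof.
move=> r0 H; apply: ge_ereal_sup => _ [f [mf f0 f1] <-].
rewrite Lnorm2_le//; last first.
  by move=> x; rewrite TopE; apply: Tk_ge0 => // y; rewrite lee_fin.
apply: H => //; move: f1; rewrite Lnorm2_le//.
by rewrite mulr1; under eq_integral do rewrite -EFinM.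
Qed.

Section bounded.
Variable r : R.
Hypotheses (r0 : (0 < r)%R) (nr : Tnorm mu k <= r%:E).

(** [Tnorm] only controls the unit ball, so [f] is divided by some [c] with [c^2] at least its
    squared norm. *)
Lemma Tk_L2_real (f : T -> R) : measurable_fun setT f -> (forall x, 0 <= f x)%R ->
  \int[mu]_x (Tk (EFin \o f) x * Tk (EFin \o f) x) <= (r * r)%:E * \int[mu]_x (f x * f x)%:E.
Proof.
move=> mf f0.
have r00 := ltW r0.
have rr : (0 < r * r)%R by rewrite mulr_gt0.
have T0 x : 0 <= Tk (EFin \o f) x by apply: Tk_ge0 => // y; rewrite lee_fin.
have mT : measurable_fun setT (Tk (EFin \o f)).
  by apply: measurable_Tk => //; exact/measurable_EFinP.
have N0 : 0 <= \int[mu]_x (f x * f x)%:E.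
  by apply: integral_ge0 => x _; rewrite lee_fin mulr_ge0.
case EN : (\int[mu]_x (f x * f x)%:E) N0 => [n| |]// N0; last first.
  by rewrite gt0_muley// leey.
rewrite lee_fin in N0.
suff H (c : R) : (0 < c)%R -> (n <= c * c)%R ->
    \int[mu]_x (Tk (EFin \o f) x * Tk (EFin \o f) x) <= ((r * r) * (c * c))%:E.
  apply/lee_addgt0Pr => e e0.
  (* The added term keeps [c] positive when [f] has norm 0, and costs exactly [e] after
     multiplication by [r^2]. *)
  pose c := Num.sqrt (n + e / (r * r))%R.
  have c0 : (0 < n + e / (r * r))%R by rewrite ltr_wpDl// divr_gt0.
  have cc : (c * c = n + e / (r * r))%R by rewrite -expr2 sqr_sqrtr// ltW.
  have nc : (n <= c * c)%R by rewrite cc lerDl divr_ge0 // ltW.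
  have c0' : (0 < c)%R by rewrite sqrtr_gt0.
  by apply: le_trans (H c c0' nc) _; rewrite cc -EFinM -EFinD lee_fin mulrDr mulrCA mulfV ?mulr1// gt_eqF.
move=> c0 nc; have c00 := ltW c0.
have ci0 : (0 <= c^-1)%R by rewrite invr_ge0.
pose g x := (c^-1 * f x)%R.
have g0 x : (0 <= g x)%R by rewrite mulr_ge0.
have mg : measurable_fun setT g by exact: measurable_funM.
have gT x : Tk (EFin \o g) x = c^-1%:E * Tk (EFin \o f) x.
  by rewrite -TkZ//; exact/measurable_EFinP.
have gn : \int[mu]_x (g x * g x)%:E <= 1.
  under eq_integral do rewrite /g mulrACA EFinM.
  rewrite ge0_integralZl_EFin//; last 3 first.
  - by move=> x _; rewrite lee_fin mulr_ge0.
  - by apply/measurable_EFinP; exact: measurable_funM.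
  - by rewrite mulr_ge0.
  rewrite EN -EFinM lee_fin -invfM mulrC ler_pdivrMr ?mulr_gt0//.
  by rewrite mul1r.
have : Lnorm mu 2%:E (Tk (EFin \o g)) <= r%:E.
  apply: le_trans nr; apply: ereal_sup_ubound; exists g => //; split => //.
  rewrite Lnorm2_le//.
  by rewrite mulr1; under eq_integral do rewrite -EFinM.
rewrite Lnorm2_le//; last by move=> x; apply: Tk_ge0 => // y; rewrite lee_fin.
under eq_integral do rewrite gT muleACA -EFinM.
rewrite ge0_integralZl_EFin//; last 3 first.
- by move=> x _; rewrite mule_ge0.
- exact: emeasurable_funM.
- by rewrite mulr_ge0.
move=> H; rewrite -(@lee_pmul2l _ (c^-1 * c^-1)%:E)//; last by rewrite lte_fin mulr_gt0 ?invr_gt0.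
apply: le_trans H _; rewrite -EFinM lee_fin.
have -> : (c^-1 * c^-1 * (r * r * (c * c)) = r * r)%R by field; rewrite gt_eqF.
by [].
Qed.

Lemma ae_fin_num_sq (f : T -> \bar R) : measurable_fun setT f -> (forall x, 0 <= f x) ->
  \int[mu]_x (f x * f x) < +oo -> {ae mu, forall x, (fine (f x))%:E = f x}.
Proof.
move=> mf f0 fi.
have : mu.-integrable setT (fun x => f x * f x).
  apply/integrableP; split; first exact: emeasurable_funM.
  by under eq_integral do rewrite gee0_abs ?mule_ge0//.
move=> /(integrable_ae measurableT); apply: filterS => x /(_ I).
by move: (f0 x); case: (f x) => [y||]//=; rewrite mulyy.
Qed.

Lemma fine_measurable_ge0 (f : T -> \bar R) : measurable_fun setT f -> (forall x, 0 <= f x) ->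
  measurable_fun setT (fine \o f) /\ (forall x, 0 <= (fine \o f) x)%R.
Proof.
by move=> mf f0; split; [exact: measurableT_comp|move=> x; exact: fine_ge0].
Qed.

(** The extended real version is what can be iterated. A function of finite square integral is
    finite almost everywhere, and [T] does not see null sets. *)
Lemma Tk_L2 (f : T -> \bar R) : measurable_fun setT f -> (forall x, 0 <= f x) ->
  \int[mu]_x (Tk f x * Tk f x) <= (r * r)%:E * \int[mu]_x (f x * f x).
Proof.
move=> mf f0.
have [fi|] := ltP (\int[mu]_x (f x * f x)) +oo; last first.
  by rewrite leye_eq => /eqP ->; rewrite gt0_muley ?lte_fin ?mulr_gt0// leey.
have ae_f := ae_fin_num_sq mf f0 fi.
have [mg g0] := fine_measurable_ge0 mf f0.
have mg' : measurable_fun setT (EFin \o (fine \o f)) by exact/measurable_EFinP.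
have -> : \int[mu]_x (f x * f x) = \int[mu]_x ((fine \o f) x * (fine \o f) x)%:E.
  apply: ge0_ae_eq_integral => //.
  - exact: emeasurable_funM.
  - by apply/measurable_EFinP; exact: measurable_funM.
  - by move=> x _; rewrite mule_ge0.
  - by move=> x _; rewrite lee_fin mulr_ge0.
  - by apply: filterS ae_f => x fx _; rewrite /= EFinM fx.
under eq_integral => x _.
  rewrite (@Tk_ae_eq f (EFin \o (fine \o f)) x)//; last by apply: filterS ae_f => y /= ->.
  over.
exact: Tk_L2_real.
Qed.

Lemma Tone_L2 n : \int[mu]_x (Tone n x * Tone n x) <= (r ^+ n * r ^+ n)%:E * mu setT.
Proof.
elim: n => [|n IH].
  by rewrite /= expr0 mulr1 !mul1e integral_cst// mul1e.
have [f0 mf] := iter_Tk_ge0_measurable fmu K n.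
apply: le_trans (Tk_L2 mf f0) _.
apply: (@le_trans _ _ ((r * r)%:E * ((r ^+ n * r ^+ n)%:E * mu setT))).
  by rewrite lee_wpmul2l// lee_fin mulr_ge0// ltW.
by rewrite muleA -EFinM exprS mulrACA.
Qed.

(* AM-GM: [2 f <= r^n + f^2 / r^n]. *)
Lemma integral_Tone_le n : \int[mu]_x Tone n x <= (r ^+ n)%:E * mu setT.
Proof.
have [f0 mf] := iter_Tk_ge0_measurable fmu K n.
pose q := (r ^+ n)%R.
have q0 : (0 < q)%R by rewrite exprn_gt0.
have H x : 2%:E * Tone n x <= q%:E + q^-1%:E * (Tone n x * Tone n x).
  move: (f0 x); case: (iter n _ _ x) => [y||]//.
    rewrite lee_fin -!EFinM -EFinD lee_fin => y0.
    have : (0 <= q^-1 * (y - q) ^+ 2)%R by rewrite mulr_ge0 ?sqr_ge0 ?invr_ge0 ?ltW.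
    have -> : (q^-1 * (y - q) ^+ 2 = q^-1 * (y * y) - 2 * y + q)%R.
      by field; rewrite gt_eqF.
    lra.
  by rewrite mulyy !gt0_muley ?lte_fin ?invr_gt0.
have sq0 x : 0 <= Tone n x * Tone n x by rewrite mule_ge0.
have msq : measurable_fun setT (fun x => Tone n x * Tone n x) by exact: emeasurable_funM.
have q00 := ltW q0.
have qi0 : (0 <= q^-1)%R by rewrite invr_ge0.
have : \int[mu]_x (2%:E * Tone n x) <= \int[mu]_x (q%:E + q^-1%:E * (Tone n x * Tone n x)).
  apply: ge0_le_integral => //.
  - by move=> x _; rewrite mule_ge0 ?lee_fin.
  - exact: measurable_funeM.
  - by apply: emeasurable_funD => //; exact: measurable_funeM.
rewrite ge0_integralD//; last 2 first.
- by move=> x _; rewrite mule_ge0 ?lee_fin.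
- exact: measurable_funeM.
rewrite !ge0_integralZl_EFin// integral_cst// => H2.
rewrite -(@lee_pmul2l _ 2%:E)//.
apply: le_trans H2 _.
apply: (@le_trans _ _ (q%:E * mu setT + q^-1%:E * ((q * q)%:E * mu setT))).
  by rewrite leeD2l// lee_wpmul2l ?lee_fin//; exact: Tone_L2.
rewrite muleA -EFinM mulrA mulVf ?gt_eqF// mul1r.
by rewrite -ge0_muleDl ?lee_fin// -EFinD muleA -EFinM mulrDl mul1r.
Qed.

End bounded.

(* [2 g(x) f(y) <= g(x)^2 v(y)/v(x) + f(y)^2 v(x)/v(y)], integrated against [k]. *)
Lemma schur_bilinear (f g v : T -> R) (s : R) : (0 <= s)%R ->
  measurable_fun setT f -> measurable_fun setT g -> measurable_fun setT v ->
  (forall x, 0 <= f x)%R -> (forall x, 0 <= g x)%R -> (forall x, 0 < v x)%R ->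
  {ae mu, forall x, Tk (EFin \o v) x <= (s * v x)%:E} ->
  2%:E * \int[mu]_x ((g x)%:E * Tk (EFin \o f) x) <=
  s%:E * (\int[mu]_x (g x * g x)%:E + \int[mu]_x (f x * f x)%:E).
Proof.
move=> s0 mf mg mv f0 g0 v0 Tv.
have v00 x := ltW (v0 x).
have mvi : measurable_fun setT (fun x => (v x)^-1)%R.
  (* As [v] is positive, its inverse is a composition of measurable functions through [ln] and
     [expR]. *)
  rewrite (_ : (fun _ => _) = fun x => expR (- ln (v x))); last first.
    by apply/funext => x; rewrite expRN lnK// posrE.
  apply: measurableT_comp => //; apply: measurableT_comp => //.
  exact: measurableT_comp.
pose G (h : T -> R) x := (h x * h x / v x)%R.
have mG (h : T -> R) : measurable_fun setT h -> measurable_fun setT (G h).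
  by move=> mh; apply: measurable_funM => //; exact: measurable_funM.
have G0 h x : (0 <= G h x)%R by rewrite divr_ge0// -expr2 sqr_ge0.
have mTk (h : T -> R) : measurable_fun setT h -> (forall x, 0 <= h x)%R -> measurable_fun setT (Tk (EFin \o h)).
  by move=> mh h0; apply: measurable_Tk => //; exact/measurable_EFinP.
have T0 (h : T -> R) x : (forall x, 0 <= h x)%R -> 0 <= Tk (EFin \o h) x.
  by move=> h0; apply: Tk_ge0.
have GT (h : T -> R) : measurable_fun setT h -> (forall x, 0 <= h x)%R ->
    \int[mu]_x ((G h x)%:E * Tk (EFin \o v) x) <= s%:E * \int[mu]_x (h x * h x)%:E.
  move=> mh h0.
  rewrite -ge0_integralZl_EFin//; last 2 first.
  - by move=> x _; rewrite lee_fin mulr_ge0.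
  - by apply/measurable_EFinP; exact: measurable_funM.
  apply: ae_ge0_le_integral => //.
  - by move=> x _; rewrite mule_ge0 ?lee_fin// T0.
  - by apply: emeasurable_funM; [apply/measurable_EFinP; exact: mG|exact: mTk].
  - by move=> x _; rewrite -EFinM lee_fin !mulr_ge0.
  - by apply: measurable_funeM; apply/measurable_EFinP; exact: measurable_funM.
  - apply: filterS Tv => x Tvx _.
    apply: (@le_trans _ _ ((G h x)%:E * (s * v x)%:E)); first by rewrite lee_wpmul2l ?lee_fin.
    rewrite -!EFinM lee_fin /G le_eqVlt; apply/orP; left; apply/eqP.
    by field; rewrite gt_eqF.
(* Integrated in [y] only. After clearing [v x * v y], the difference of the integrands is [k x y]
   times the square of [g x * v y - f y * v x]. *)
have pt x : 2%:E * ((g x)%:E * Tk (EFin \o f) x) <=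
    (G g x)%:E * Tk (EFin \o v) x + (v x)%:E * Tk (EFin \o G f) x.
  have mE (h : T -> R) : measurable_fun setT h -> measurable_fun setT (EFin \o h) by move=> ?; exact/measurable_EFinP.
  have mkE (c : R) (h : T -> R) : measurable_fun setT h ->
      measurable_fun setT (fun y => (k x y)%:E * (c%:E * (EFin \o h) y)).
    by move=> mh; apply: emeasurable_funM; [exact: mE|apply: measurable_funeM; exact: mE].
  have kE (c : R) (h : T -> R) y : (0 <= c)%R -> (0 <= h y)%R -> 0 <= (k x y)%:E * (c%:E * (EFin \o h) y).
    by move=> c0 h0; rewrite !mule_ge0 ?lee_fin.
  rewrite muleA -EFinM -!TkZ ?mulr_ge0 ?invr_ge0//;
    [|exact: mE|exact: mE|by apply: mE; exact: mG|by move=> y; rewrite lee_fin].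
  rewrite /integral_operator -ge0_integralD//; last 4 first.
  - by move=> y _; exact: kE.
  - exact: mkE.
  - by move=> y _; exact: kE.
  - by apply: mkE; exact: mG.
  apply: ge0_le_integral => //.
  - by move=> y _; rewrite kE// mulr_ge0.
  - exact: mkE.
  - by apply: emeasurable_funD; [exact: mkE|apply: mkE; exact: mG].
  - move=> y _; rewrite /= -!EFinM -EFinD lee_fin -mulrDr ler_wpM2l// -subr_ge0.
    have -> : (G g x * v y + v x * G f y - 2 * g x * f y =
        (g x * v y - f y * v x) ^+ 2 / (v x * v y))%R.
      by rewrite /G; field; rewrite !gt_eqF.
    by rewrite divr_ge0 ?sqr_ge0// mulr_ge0.
rewrite -ge0_integralZl_EFin//; last 2 first.
- by move=> x _; rewrite mule_ge0 ?lee_fin// T0.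
- by apply: emeasurable_funM; [exact/measurable_EFinP|exact: mTk].
apply: (@le_trans _ _ (\int[mu]_x ((G g x)%:E * Tk (EFin \o v) x + (v x)%:E * Tk (EFin \o G f) x))).
  apply: ge0_le_integral => //.
  - by move=> x _; rewrite !mule_ge0 ?lee_fin// T0.
  - by apply: measurable_funeM; apply: emeasurable_funM; [exact/measurable_EFinP|exact: mTk].
  - apply: emeasurable_funD; apply: emeasurable_funM.
    + by apply/measurable_EFinP; exact: mG.
    + exact: mTk.
    + exact/measurable_EFinP.
    + by apply: mTk => //; exact: mG.
rewrite ge0_integralD//; last 4 first.
- by move=> x _; rewrite mule_ge0 ?lee_fin// T0.
- by apply: emeasurable_funM; [apply/measurable_EFinP; exact: mG|exact: mTk].
- by move=> x _; rewrite mule_ge0 ?lee_fin// T0.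
- by apply: emeasurable_funM; [exact/measurable_EFinP|apply: mTk => //; exact: mG].
have mEGf : measurable_fun setT (EFin \o G f) by apply/measurable_EFinP; exact: mG.
have mEv : measurable_fun setT (EFin \o v) by exact/measurable_EFinP.
have EGf0 x : 0 <= (EFin \o G f) x by rewrite lee_fin.
have Ev0 x : 0 <= (EFin \o v) x by rewrite lee_fin.
(* Self-adjointness moves [T] onto [v] in the [f] term, so that [GT] bounds both halves. *)
rewrite (Tk_sym fmu K mEGf mEv EGf0 Ev0).
rewrite ge0_muleDr; last 2 first.
- by apply: integral_ge0 => x _; rewrite lee_fin mulr_ge0.
- by apply: integral_ge0 => x _; rewrite lee_fin mulr_ge0.
by apply: leeD; exact: GT.
Qed.

(** With [N] and [F] the squared norms of [T f] and [f], the bilinear bound at [g = l * T f] reads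
    [2 l N <= l N + F / l], whence [N <= F / l^2]. Cancelling [l N] needs [N] finite, which is why
    an a priori bound [r] on the norm is assumed. *)
Lemma schur_test (l r : R) (u : T -> \bar R) : (0 < l)%R ->
  Tnorm mu k <= r%:E -> (0 < r)%R ->
  measurable_fun setT u -> (forall x, 1 <= u x) -> \int[mu]_x u x < +oo ->
  (forall x, l%:E * Tk u x <= u x) ->
  Tnorm mu k <= (l^-1)%:E.
Proof.
move=> l0 nr r0 mu_ u1 ui Tu.
have u0 x : 0 <= u x by apply: le_trans (u1 x); rewrite lee01.
have li0 : (0 < l^-1)%R by rewrite invr_gt0.
have ae_u : {ae mu, forall x, u x \is a fin_num}.
  have : mu.-integrable setT u.
    by apply/integrableP; split => //; under eq_integral do rewrite gee0_abs//.
  by move=> /(integrable_ae measurableT); apply: filterS => x /(_ I).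
(* A real weight, positive everywhere, that equals [u] wherever [u] is finite, hence almost
   everywhere. *)
pose v x := Num.max 1%R (fine (u x)).
have mv : measurable_fun setT v.
  by apply: measurable_maxr => //; exact: measurableT_comp.
have v0 x : (0 < v x)%R by rewrite lt_max ltr01.
have uv x : u x \is a fin_num -> u x = (v x)%:E.
  move=> ux; rewrite /v max_r ?fineK// -lee_fin fineK//.
have Tv : {ae mu, forall x, Tk (EFin \o v) x <= (l^-1 * v x)%:E}.
  apply: filterS (ae_u) => x ux.
  have -> : Tk (EFin \o v) x = Tk u x.
    apply: Tk_ae_eq => //; first exact/measurable_EFinP.
      by move=> y; rewrite lee_fin ltW.
    by apply: filterS ae_u => y /uv ->.
  rewrite EFinM -(uv x ux) -(@lee_pmul2l _ l%:E)// muleA -EFinM mulfV ?gt_eqF//.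
  by rewrite mul1e.
apply: Tnorm_le => [|f mf f0 f1]; first exact: ltW.
pose h := Tk (EFin \o f).
have mEf : measurable_fun setT (EFin \o f) by exact/measurable_EFinP.
have h0 x : 0 <= h x by apply: Tk_ge0 => // y; rewrite lee_fin.
have mh : measurable_fun setT h by apply: measurable_Tk => // x; rewrite lee_fin.
have h_fin : \int[mu]_x (h x * h x) < +oo.
  apply: le_lt_trans (Tk_L2_real r0 nr mf f0) _.
  apply: (@le_lt_trans _ _ ((r * r)%:E * 1)); last by rewrite mule1 ltry.
  by rewrite lee_wpmul2l// lee_fin mulr_ge0// ltW.
have [mh' h'0] := fine_measurable_ge0 mh h0.
have ae_h := ae_fin_num_sq mh h0 h_fin.
pose g x := (l * fine (h x))%R.
have mg : measurable_fun setT g by exact: measurable_funM.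
have g0 x : (0 <= g x)%R by rewrite mulr_ge0 ?(ltW l0)//; exact: h'0.
have := schur_bilinear (ltW li0) mf mg mv f0 g0 v0 Tv.
have -> : \int[mu]_x ((g x)%:E * Tk (EFin \o f) x) = l%:E * \int[mu]_x (h x * h x).
  rewrite -ge0_integralZl_EFin ?(ltW l0)//; last 2 first.
  - by move=> x _; rewrite mule_ge0.
  - exact: emeasurable_funM.
  apply: ge0_ae_eq_integral => //.
  - by apply: emeasurable_funM => //; exact/measurable_EFinP.
  - by apply: measurable_funeM; exact: emeasurable_funM.
  - by move=> x _; rewrite mule_ge0 ?lee_fin.
  - by move=> x _; rewrite !mule_ge0 ?lee_fin// ltW.
  - by apply: filterS ae_h => x hx _; rewrite /g EFinM hx -muleA.
have -> : \int[mu]_x (g x * g x)%:E = (l * l)%:E * \int[mu]_x (h x * h x).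
  rewrite -ge0_integralZl_EFin ?mulr_ge0 ?(ltW l0)//; last 2 first.
  - by move=> x _; rewrite mule_ge0.
  - exact: emeasurable_funM.
  apply: ge0_ae_eq_integral => //.
  - by apply/measurable_EFinP; exact: measurable_funM.
  - by apply: measurable_funeM; exact: emeasurable_funM.
  - by move=> x _; rewrite lee_fin mulr_ge0.
  - by move=> x _; rewrite !mule_ge0 ?lee_fin ?mulr_ge0// ltW.
  - by apply: filterS ae_h => x hx _; rewrite /g mulrACA !EFinM hx.
have N0 : 0 <= \int[mu]_x (h x * h x) by apply: integral_ge0 => x _; rewrite mule_ge0.
have F0 : 0 <= \int[mu]_x (f x * f x)%:E.
  by apply: integral_ge0 => x _; rewrite lee_fin mulr_ge0.
case: (\int[mu]_x (h x * h x)) N0 h_fin => [N||]// N0 _.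
case: (\int[mu]_x (f x * f x)%:E) f1 F0 => [F||]// F1 F0.
rewrite lee_fin in F1; rewrite lee_fin in F0; rewrite lee_fin in N0.
rewrite -!EFinM !lee_fin.
have -> : (l^-1 * (l * l * N + F) = l * N + l^-1 * F)%R.
  by field; rewrite gt_eqF.
move=> H.
rewrite -(@ler_pM2l _ l)//.
have -> : (l * (l^-1 * l^-1) = l^-1)%R by field; rewrite gt_eqF.
have : (l^-1 * F <= l^-1)%R by rewrite ler_piMr// ltW.
lra.
Qed.

End L2.

(** * Real power series *)

Section power_series.
Context {R : realType}.
Implicit Types (a c : nat -> R).

Lemma ler_series_lim (u : nat -> R) (l : R) n : (forall i, 0 <= u i) ->
  series u @ \oo --> l -> \sum_(0 <= i < n) u i <= l.
Proof.
move=> u0 ul; rewrite -(cvg_lim _ ul)//; apply: nondecreasing_cvgn_le.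
  by apply/nondecreasing_seqP => m; rewrite /series/= big_nat_recr//= lerDl.
by apply/cvg_ex; exists l.
Qed.

Lemma coef_bound (u : nat -> R) (l : R) : series u @ \oo --> l ->
  exists M, forall n, `|u n| <= M.
Proof.
move=> ul; have /cvg_series_bounded[M [_ MP]] : cvgn (series u) by apply/cvg_ex; exists l.
by exists (M + 1) => n; apply: (MP (M + 1)) => //; rewrite ltrDl.
Qed.

(* The remainder beyond [d k * h ^+ k] is [O(h ^+ k.+1)] by comparison with a geometric series. *)
Lemma pseries_eq0 (d : nat -> R) (r : R) : 0 < r ->
  (forall h, 0 < h -> h <= r -> series (fun n => d n * h ^+ n) @ \oo --> 0) ->
  forall k, d k = 0.
Proof.
move=> r0 dr; have [M MP] := coef_bound (dr r r0 (lexx _)).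
have M0 : 0 <= M := le_trans (normr_ge0 _) (MP 0%N).
elim/ltn_ind => k IH; apply/eqP; rewrite -normr_le0.
suff H h : 0 < h -> h <= r / 2 -> `|d k| <= 2 * M / r ^+ k.+1 * h.
  apply/ler_addgt0Pr => e e0; rewrite add0r.
  (* The [+ 1] makes [C] positive even when [M = 0], so that [e / C] is a valid choice of [h]. *)
  pose C := 2 * M / r ^+ k.+1 + 1.
  have C0 : 0 < C by rewrite /C ltr_wpDl// mulr_ge0 ?invr_ge0 ?exprn_ge0 ?(ltW r0)// mulr_ge0.
  have hC : 0 < Num.min (r / 2) (e / C) by rewrite lt_min !divr_gt0.
  apply: le_trans (H _ hC _) _; first by rewrite ge_min lexx.
  apply: (@le_trans _ _ (C * Num.min (r / 2) (e / C))).
    by rewrite ler_wpM2r ?(ltW hC)// lerDl.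
  by rewrite mulrC -ler_pdivlMr// ge_min lexx orbT.
move=> h0 hr; pose q := h / r.
have q0 : 0 < q by rewrite divr_gt0.
have q2 : q <= 2^-1 by rewrite ler_pdivrMr//; lra.
(* The subtracted term is what closes the induction, using [q <= 1/2]; only the bound 2 is kept
   later. *)
have geo n : \sum_(0 <= i < n) q ^+ i <= 2 - 2 * q ^+ n.
  elim: n => [|n IHn]; first by rewrite big_nil expr0; lra.
  rewrite big_nat_recr//= exprSr.
  have : 0 <= q ^+ n * (2^-1 - q) by rewrite mulr_ge0 ?exprn_ge0 ?(ltW q0)// subr_ge0.
  by lra.
have key N : `|\sum_(0 <= i < N) d (i + k.+1)%N * h ^+ (i + k.+1)| <= 2 * M * q ^+ k.+1.
  apply: le_trans (ler_norm_sum _ _ _) _.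
  apply: (@le_trans _ _ (\sum_(0 <= i < N) M * q ^+ k.+1 * q ^+ i)).
    apply: ler_sum => i _.
    have -> : d (i + k.+1)%N * h ^+ (i + k.+1) =
        d (i + k.+1)%N * r ^+ (i + k.+1) * (q ^+ k.+1 * q ^+ i).
      rewrite -exprD addnC -mulrA; congr (_ * _).
      by rewrite /q expr_div_n mulrC mulfVK// expf_neq0// gt_eqF.
    rewrite normrM [X in _ * X]ger0_norm ?mulr_ge0 ?exprn_ge0 ?(ltW q0)//.
    by rewrite -mulrA ler_wpM2r// ?mulr_ge0 ?exprn_ge0 ?(ltW q0).
  rewrite -mulr_sumr (_ : 2 * M * q ^+ k.+1 = M * q ^+ k.+1 * 2); last by ring.
  rewrite ler_wpM2l ?mulr_ge0 ?exprn_ge0 ?(ltW q0)//.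
  by apply: le_trans (geo N) _; rewrite gerBl mulr_ge0 ?exprn_ge0 ?(ltW q0).
have dh : `|d k * h ^+ k| <= 2 * M * q ^+ k.+1.
  apply/ler_addgt0Pl => e e0.
  have hr' : h <= r by lra.
  have /cvgr_dist_le/(_ e e0)[N _ NP] := dr h h0 hr'.
  (* This partial sum consists of [k] terms that vanish by induction, the term of index [k], and the
     [N] terms bounded by [key]. *)
  have := NP (N + k.+1)%N (leq_addr _ _).
  rewrite /= sub0r normrN /series/= addnC.
  rewrite (@big_cat_nat _ _ _ k)//=; last by rewrite addSn ltnW// ltnS leq_addr.
  rewrite big_nat_cond big1 ?add0r; last first.
    by move=> i /andP[/andP[_ ik] _]; rewrite IH// mul0r.
  rewrite big_ltn; last by rewrite addSn ltnS leq_addr.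
  rewrite -[X in \sum_(X <= _ < _) _]add0n big_addn addKn => A.
  have := key N; move: A.
  set S := \sum_(_ <= _ < _) _.
  have := ler_normD (d k * h ^+ k + S) (- S); rewrite addrK normrN; lra.
move: dh; rewrite normrM [X in _ * X]gtr0_norm ?exprn_gt0//.
rewrite -ler_pdivlMr ?exprn_gt0// => /le_trans; apply.
rewrite /q expr_div_n exprS le_eqVlt; apply/orP; left; apply/eqP.
field.
by rewrite !gt_eqF// exprn_gt0.
Qed.

(** * Exchange of summation in absolutely convergent double series *)

Lemma cvg_sum_nat (u : nat -> nat -> R) (l : nat -> R) N :
  (forall j, u j n @[n --> \oo] --> l j) ->
  \sum_(0 <= j < N) u j n @[n --> \oo] --> \sum_(0 <= j < N) l j.
Proof.
move=> ul; apply: cvg_big => //; exact: add_continuous.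
Qed.

Lemma dominated_series (t v : nat -> R) : (forall m, `|t m| <= v m) ->
  cvgn (series v) ->
  cvgn (series t) /\
  forall M, `|limn (series t) - series t M| <= limn (series v) - series v M.
Proof.
move=> tv cv.
have v0 m : 0 <= v m := le_trans (normr_ge0 _) (tv m).
have ct : cvgn (series t).
  by apply: normed_cvg; apply: (series_le_cvg _ v0 tv cv) => n.
split => // M.
have ctM : `|series t n - series t M| @[n --> \oo] --> `|limn (series t) - series t M|.
  by apply: cvg_norm; apply: (@cvgB _ R^o) => //; exact: cvg_cst.
rewrite -(cvg_lim _ ctM)//; apply: limr_le; first by apply/cvg_ex; exists (`|limn (series t) - series t M|).
exists M => // n /= Mn; rewrite !(sub_series_geq _ Mn).
apply: le_trans (ler_norm_sum _ _ _) _.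
apply: le_trans (ler_sum _ (fun i _ => tv i)) _.
rewrite -(sub_series_geq v Mn) lerD2r; apply: nondecreasing_cvgn_le => //.
by apply/nondecreasing_seqP => m; rewrite /series/= big_nat_recr//= lerDl.
Qed.

Section double_series.
Variables (u : nat -> nat -> R) (v w : nat -> R).
Hypotheses (uv : forall m N, \sum_(0 <= j < N) `|u m j| <= v m)
  (cv : cvgn (series v))
  (uw : forall m N, (m < N)%N -> \sum_(0 <= j < N) u m j = w m).

Lemma double_series_col j : cvgn (series (u ^~ j)).
Proof.
apply: (dominated_series _ cv).1 => m; apply: le_trans (uv m j.+1).
by rewrite big_nat_recr//= lerDr sumr_ge0.
Qed.

Let col j := limn (series (u ^~ j)).

Let weighted_cols (s : nat -> R) N :
  series (fun m => \sum_(0 <= j < N) s j * u m j) n @[n --> \oo] --> \sum_(0 <= j < N) s j * col j.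
Proof.
rewrite (_ : series _ = fun n => \sum_(0 <= j < N) s j * series (u ^~ j) n); last first.
  apply/funext => n; rewrite /series/= exchange_big/=.
  by apply: eq_bigr => j _; rewrite mulr_sumr.
by apply: cvg_sum_nat => j; apply: (cvgM (cvg_cst _) (@double_series_col j)).
Qed.

(** Weighting each column by the sign of its sum removes the absolute values. Every weighted row is
    still at most [v m], so the limit over the rows is bounded by the sum of [v]. *)
Lemma double_series_abs N : \sum_(0 <= j < N) `|col j| <= limn (series v).
Proof.
pose s j := Num.sg (col j).
have -> : \sum_(0 <= j < N) `|col j| = \sum_(0 <= j < N) s j * col j.
  by apply: eq_bigr => j _; rewrite normrEsg.
have sv m : `|\sum_(0 <= j < N) s j * u m j| <= v m.
  apply: le_trans (ler_norm_sum _ _ _) _; apply: le_trans (uv m N).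
  apply: ler_sum => j _; rewrite normrM ler_piMl// normr_sg.
  by case: (_ != 0); rewrite ?ler01.
have [_ /(_ 0%N)] := dominated_series sv cv.
have ser0 (f : nat -> R) : series f 0%N = 0 by rewrite /series/= big_geq.
rewrite (cvg_lim _ (@weighted_cols s N))// !ser0 !subr0.
exact: le_trans (ler_norm _).
Qed.

(** By [uw] the first [M] rows are complete within [N] columns as soon as [M <= N]. The two sums
    then differ only in the rows beyond [M], and both of these remainders are at most the tail of
    [v]. *)
Lemma double_series_swap : series col @ \oo --> limn (series w).
Proof.
have wv m : `|w m| <= v m.
  by rewrite -(@uw m m.+1)//; apply: le_trans (ler_norm_sum _ _ _) (uv _ _).
apply/cvgrPdist_le => e e0.
have e2 : 0 < e / 2 by rewrite divr_gt0.
have /cvgrPdist_le/(_ _ e2)[M _ MP] := cv.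
exists M => // N /= MN.
have tail : limn (series v) - series v M <= e / 2.
  exact: le_trans (ler_norm _) (MP M (leqnn _)).
have [_ /(_ M) wM] := dominated_series wv cv.
have uvN m : `|\sum_(0 <= j < N) 1 * u m j| <= v m.
  under eq_bigr do rewrite mul1r.
  exact: le_trans (ler_norm_sum _ _ _) (uv m N).
have [_ /(_ M)] := dominated_series uvN cv.
rewrite (cvg_lim _ (@weighted_cols (cst 1) N))//.
have -> : \sum_(0 <= j < N) cst 1 j * col j = series col N.
  by rewrite /series/=; apply: eq_bigr => j _; rewrite mul1r.
have -> : series (fun m => \sum_(0 <= j < N) 1 * u m j) M = series w M.
  rewrite /series/= big_nat_cond [RHS]big_nat_cond; apply: eq_bigr => m /andP[/andP[_ mM] _].
  by under eq_bigr do rewrite mul1r; apply: uw; exact: leq_trans mM MN.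
move=> uM.
rewrite -(subrK (series w M) (limn _)) -addrA.
apply: le_trans (ler_normD _ _) _; rewrite [`|series w M - _|]distrC.
by lra.
Qed.

End double_series.

Lemma exprD_sum_nat (x h : R) m N : (m < N)%N ->
  \sum_(0 <= j < N) 'C(m, j)%:R * x ^+ (m - j) * h ^+ j = (x + h) ^+ m.
Proof.
move=> mN; rewrite (@big_cat_nat _ _ _ m.+1)//= [X in _ + X]big_nat_cond.
rewrite [X in _ + X]big1 ?addr0; last first.
  by move=> j /andP[/andP[mj _] _]; rewrite bin_small// !mul0r.
by rewrite exprDn big_mkord; apply: eq_bigr => j _; rewrite -mulrA mulr_natl.
Qed.

Lemma exprD_sum_le (x h : R) m N : 0 <= x -> 0 <= h ->
  \sum_(0 <= j < N) 'C(m, j)%:R * x ^+ (m - j) * h ^+ j <= (x + h) ^+ m.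
Proof.
move=> x0 h0; rewrite -(@exprD_sum_nat x h m (N + m.+1)) ?ltn_addl//.
rewrite [leRHS](@big_cat_nat _ _ _ N)//= ?leq_addr// lerDl sumr_ge0// => j _.
by rewrite !mulr_ge0 ?exprn_ge0.
Qed.

(** * Expansion of a power series about another centre *)

Section recentering.
Variables (a : nat -> R) (x r : R).
Hypotheses (r0 : 0 < r)
  (ca : cvgn (series (fun m => `|a m| * (`|x| + r) ^+ m))).

(** Summed over [m], these give the Taylor coefficient of index [j] at [x]. For [m < j] the
    truncated subtraction is harmless, as the binomial coefficient is 0. *)
Definition recenter_term j m := a m * 'C(m, j)%:R * x ^+ (m - j).

Definition recenter j := limn (series (recenter_term j)).

Let u h m j := recenter_term j m * h ^+ j.

Let uv h : `|h| <= r -> forall m N, \sum_(0 <= j < N) `|u h m j| <= `|a m| * (`|x| + r) ^+ m.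
Proof.
move=> hr m N; apply: (@le_trans _ _ (\sum_(0 <= j < N)
    `|a m| * ('C(m, j)%:R * `|x| ^+ (m - j) * r ^+ j))).
  apply: ler_sum => j _; rewrite /u /recenter_term !normrM !normrX normr_nat -!mulrA.
  by rewrite !ler_wpM2l ?exprn_ge0// lerXn2r// ?nnegrE// ltW.
by rewrite -mulr_sumr ler_wpM2l// exprD_sum_le// ltW.
Qed.

Lemma recenter_cvg j : cvgn (series (recenter_term j)).
Proof.
have rr : `|r| <= r by rewrite gtr0_norm.
have cj : cvgn (series ((u r) ^~ j)) := @double_series_col _ _ (uv rr) ca j.
have -> : series (recenter_term j) = (fun n => series ((u r) ^~ j) n * r ^- j).
  apply/funext => n; rewrite /series/= mulr_suml; apply: eq_bigr => m _.
  by rewrite /u mulfK// expf_neq0// gt_eqF.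
exact: (is_cvgM cj (is_cvg_cst _)).
Qed.

Let colE h j : limn (series ((u h) ^~ j)) = recenter j * h ^+ j.
Proof.
apply/cvg_lim => //.
rewrite (_ : series _ = fun n => series (recenter_term j) n * h ^+ j); last first.
  by apply/funext => n; rewrite /series/= mulr_suml.
exact: (cvgM (@recenter_cvg j) (cvg_cst _)).
Qed.

Lemma recenter_sum h : `|h| <= r ->
  series (fun j => recenter j * h ^+ j) @ \oo --> limn (series (fun m => a m * (x + h) ^+ m)).
Proof.
move=> hr; rewrite (_ : (fun j => _) = fun j => limn (series ((u h) ^~ j))); last first.
  by apply/funext => j; rewrite colE.
apply: (double_series_swap (uv hr) ca) => m N mN.
rewrite -(exprD_sum_nat x h mN) mulr_sumr; apply: eq_bigr => j _.
by rewrite /u /recenter_term !mulrA.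
Qed.

Lemma recenter_abs_le h N : `|h| <= r ->
  \sum_(0 <= j < N) `|recenter j * h ^+ j| <= limn (series (fun m => `|a m| * (`|x| + r) ^+ m)).
Proof.
move=> hr; apply: le_trans (double_series_abs (uv hr) ca N).
by rewrite le_eqVlt; apply/orP; left; apply/eqP; apply: eq_bigr => j _; rewrite colE.
Qed.

End recentering.

Lemma pseries_nneg_analytic (c : nat -> R) (F : R -> R) (D : set R) (x r : R) :
  (forall n, 0 <= c n) -> 0 <= x -> 0 < r ->
  cvgn (series (fun n => c n * (x + r) ^+ n)) ->
  (forall y, D y -> F y = limn (series (fun n => c n * y ^+ n))) ->
  analytic_at_in F D x.
Proof.
move=> c0 x0 r0 cr FE; exists r => //; exists (recenter c x) => y yr Dy.
have ca : cvgn (series (fun n => `|c n| * (`|x| + r) ^+ n)).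
  by rewrite ger0_norm//; under eq_fun do rewrite ger0_norm//.
by have := recenter_sum r0 ca (ltW yr); rewrite (FE _ Dy) subrKC.
Qed.

(* Pringsheim: at a point [l - e] left of the singularity, the Taylor coefficients
   of the two expansions agree and are nonnegative; the disc of the expansion at [l]
   then gives convergence at [l + e]. *)
Lemma pringsheim (c : nat -> R) (F : R -> R) (D : set R) (l : R) :
  (forall n, 0 <= c n) -> 0 < l ->
  (forall y, 0 < y -> y < l -> D y /\ cvgn (series (fun n => c n * y ^+ n)) /\
     F y = limn (series (fun n => c n * y ^+ n))) ->
  analytic_at_in F D l ->
  exists2 y, l < y & cvgn (series (fun n => c n * y ^+ n)).
Proof.
move=> c0 l0 FE [del del0 [a aP]].
(* At the centre [l - e], the series [c] is expanded with radius [e / 2], staying left of [l], and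
   the series [a] with radius [2 * e]. The latter needs absolute convergence at distance [3 * e]
   from [l], obtained from convergence at [- (4 * e)]; the 8 keeps that point inside the domain. The
   increment [2 * e] then reaches [l + e], beyond [l]. *)
pose e := Num.min del l / 8.
have m0 : 0 < Num.min del l by rewrite lt_min del0.
have e0 : 0 < e by rewrite divr_gt0.
have e8 : 8 * e = Num.min del l by rewrite /e mulrC divfK.
have ed : 8 * e <= del by rewrite e8 ge_min lexx.
have el : 8 * e <= l by rewrite e8 ge_min lexx orbT.
have ax h : - (8 * e) < h -> h < 0 -> series (fun n => a n * h ^+ n) @ \oo --> F (l + h).
  move=> h1 h2; have [||Dlh _] := FE (l + h); [lra|lra|].
  have := aP (l + h); rewrite [l + h]addrC addrK; apply => //; last by rewrite addrC.
  by rewrite ltr_norml; apply/andP; split; lra.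
have ca : cvgn (series (fun m => `|a m| * (`|- e| + 2 * e) ^+ m)).
  rewrite normrN gtr0_norm//.
  have c4 : cvgn (pseries a (- (4 * e))).
    by apply/cvg_ex; exists (F (l - 4 * e)); apply: ax; lra.
  apply: (is_cvg_pseries_inside_norm c4).
  by rewrite normrN !gtr0_norm; lra.
have e2 : 0 < 2 * e by lra.
have e12 : 0 < e / 2 by lra.
have x0 : 0 < l - e by lra.
have cc : cvgn (series (fun m => `|c m| * (`|l - e| + e / 2) ^+ m)).
  rewrite gtr0_norm//; under eq_fun do rewrite ger0_norm//.
  by have [||_ []] := FE (l - e + e / 2); [lra|lra|].
(* For [0 < h <= e / 2] both expansions sum to [F (l - e + h)]. *)
have bb j : recenter c (l - e) j = recenter a (- e) j.
  apply/eqP; rewrite -subr_eq0; apply/eqP.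
  apply: (@pseries_eq0 (fun j => recenter c (l - e) j - recenter a (- e) j) (e / 2)) => //.
  move=> h h0 he.
  have h1 : `|h| <= e / 2 by rewrite gtr0_norm.
  have h2 : `|h| <= 2 * e by rewrite gtr0_norm//; lra.
  have A := recenter_sum e12 cc h1.
  have B := recenter_sum e2 ca h2.
  have [||_ [_ FA]] := FE (l - e + h); [lra|lra|].
  have FB : limn (series (fun m => a m * (- e + h) ^+ m)) = F (l - e + h).
    by rewrite -addrA; apply/cvg_lim => //; apply: ax; lra.
  rewrite FB in B.
  rewrite -(subrr (F (l - e + h))).
  rewrite (_ : series _ = series (fun n => recenter c (l - e) n * h ^+ n) -
      series (fun n => recenter a (- e) n * h ^+ n)).
    by apply: (@cvgB _ R^o) B; rewrite FA.
  apply/funext => n; rewrite /series/= !fctE/= -sumrB.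
  by apply: eq_bigr => i _; rewrite mulrBl.
exists (l + e); first by lra.
apply: nondecreasing_is_cvgn.
  apply/nondecreasing_seqP => m.
  by rewrite /series/= big_nat_recr//= lerDl mulr_ge0// exprn_ge0//; lra.
exists (limn (series (fun m => `|a m| * (`|- e| + 2 * e) ^+ m))) => _ [M _ <-].
have h2 : `|2 * e| <= 2 * e by rewrite gtr0_norm.
apply: le_trans (recenter_abs_le e2 ca M h2).
(* The binomial expansion about [l - e] makes this a finite square block of nonnegative terms. Each
   of its column sums is at most [recenter c (l - e) j], which [bb] replaces by the coefficient of
   the convergent expansion of [a]. *)
have -> : series (fun n => c n * (l + e) ^+ n) M =
    \sum_(0 <= j < M) (\sum_(0 <= m < M) recenter_term c (l - e) j m) * (2 * e) ^+ j.
  rewrite /series/=; under [RHS]eq_bigr do rewrite mulr_suml.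
  rewrite exchange_big/= big_nat_cond [RHS]big_nat_cond.
  apply: eq_bigr => m /andP[/andP[_ mM] _].
  have -> : l + e = l - e + 2 * e by ring.
  rewrite -(exprD_sum_nat (l - e) (2 * e) mM) mulr_sumr; apply: eq_bigr => j _.
  by rewrite /recenter_term !mulrA.
apply: ler_sum => j _; rewrite -bb; apply: le_trans (ler_norm _).
rewrite ler_wpM2r ?exprn_ge0 ?(ltW e2)//.
apply: (ler_series_lim (u := recenter_term c (l - e) j)); last exact: (@recenter_cvg _ _ _ e12 cc).
by move=> m; rewrite /recenter_term !mulr_ge0 ?exprn_ge0 ?(ltW x0).
Qed.

End power_series.

(** * The susceptibility as a power series *)

Section ereal_power_series.
Context {R : realType}.
Variable D : nat -> \bar R.
Hypothesis D0 : forall n, (0 <= D n)%E.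
Local Open Scope ereal_scope.

(** The coefficients are extended reals because [T^n 1 (x)] may be infinite at particular points
    [x]. *)
Definition epseries (l : R) : \bar R := \sum_(0 <= n <oo) (l ^+ n)%:E * D n.

Let term_ge0 (l : R) n : (0 <= l)%R -> 0 <= (l ^+ n)%:E * D n.
Proof. by move=> l0; rewrite mule_ge0 ?lee_fin ?exprn_ge0. Qed.

Lemma epseries_le (l1 l2 : R) : (0 <= l1)%R -> (l1 <= l2)%R -> epseries l1 <= epseries l2.
Proof.
move=> l10 l12; apply: lee_nneseries => n *; first exact: term_ge0.
by rewrite lee_wpmul2r// lee_fin lerXn2r// nnegrE (le_trans l10).
Qed.

(** Some partial sum [P] of length [N] at [l0] already exceeds [a]. For [0 < l < l0] the one at [l]
    is at least [(l / l0)^N * P], where the factor is positive and tends to 1; this also covers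
    infinite [P]. *)
Lemma epseries_left_gt (l0 a : R) : (0 < l0)%R -> a%:E < epseries l0 ->
  \forall l \near l0^'-, a%:E < epseries l.
Proof.
move=> l00 aL.
have [N aN] : exists N, a%:E < \sum_(0 <= n < N) (l0 ^+ n)%:E * D n.
  apply: contrapT => /forallNP H; move: aL; rewrite ltNge => /negP; apply.
  apply: lime_le; first by apply: is_cvg_nneseries => n _ _; exact/term_ge0/ltW.
  by apply: nearW => n; rewrite leNgt; apply/negP.
set P := \sum_(0 <= n < N) _ in aN.
have lower l : (0 < l)%R -> (l < l0)%R -> ((l / l0) ^+ N)%:E * P <= epseries l.
  move=> lp ll; have q0 : (0 <= l / l0)%R by rewrite divr_ge0// ltW.
  have q1 : (l / l0 <= 1)%R by rewrite ler_pdivrMr// mul1r ltW.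
  apply: (@le_trans _ _ (\sum_(0 <= n < N) (l ^+ n)%:E * D n)); last first.
    by apply: nneseries_lim_ge => n _ _; exact/term_ge0/ltW.
  rewrite /P ge0_sume_distrr; last by move=> n _; exact/term_ge0/ltW.
  rewrite big_nat_cond [leRHS]big_nat_cond; apply: lee_sum => n /andP[/andP[_ nN] _].
  rewrite muleA lee_wpmul2r// -EFinM lee_fin.
  apply: (@le_trans _ _ ((l / l0) ^+ n * l0 ^+ n)%R).
    by rewrite ler_wpM2r ?exprn_ge0 ?(ltW l00)// ler_wiXn2l// ltnW.
  by rewrite -exprMn divfK// gt_eqF.
have P0 : 0 <= P by apply: sume_ge0 => n _; exact/term_ge0/ltW.
have near_pos : \forall l \near l0^'-, (0 < l)%R by exact: nbhs_left_gt.
have near_lt : \forall l \near l0^'-, (l < l0)%R by exact: nbhs_left_lt.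
case EP : P P0 aN lower => [p||]// P0 aN lower; last first.
  apply: filterS2 near_pos near_lt => l lp ll.
  apply: lt_le_trans (lower l lp ll).
  by rewrite gt0_muley ?ltry// lte_fin exprn_gt0// divr_gt0.
have cont : ((l / l0) ^+ N * p)%R @[l --> l0] --> ((l0 / l0) ^+ N * p)%R.
  apply: cvgM; last exact: cvg_cst.
  apply: (@continuous_cvg _ _ _ _ _ _ (fun x : R => x ^+ N)%R); first exact: exprn_continuous.
  by apply: cvgM; [exact: cvg_id|exact: cvg_cst].
have := cvgr_gt _ (cvg_at_left_filter cont) a.
rewrite mulfV ?gt_eqF// expr1n mul1r -lte_fin => /(_ _ aN).
apply: filterS3 near_pos near_lt => l lp ll al.
by apply: lt_le_trans (lower l lp ll); rewrite -EFinM lte_fin.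
Qed.

Lemma epseries_cvg_left (f : R -> \bar R) (l0 : R) : (0 < l0)%R ->
  (forall l, (0 < l)%R -> f l = epseries l) ->
  f l @[l --> l0^'-] --> f l0.
Proof.
move=> l00 fE.
have near_pos : \forall l \near l0^'-, (0 < l)%R by exact: nbhs_left_gt.
have near_lt : \forall l \near l0^'-, (l < l0)%R by exact: nbhs_left_lt.
have gtf (a : R) : a%:E < f l0 -> \forall l \near l0^'-, a%:E < f l.
  rewrite fE// => /(epseries_left_gt l00); apply: filterS2 near_pos => l lp.
  by rewrite fE.
have : 0 <= f l0 by rewrite fE//; apply: nneseries_ge0 => n *; exact/term_ge0/ltW.
case E : (f l0) => [L||]// L0; last by apply/cvgeyPgt => a; apply: gtf; rewrite E ltry.
have lef l : (0 < l)%R -> (l < l0)%R -> 0 <= f l <= L%:E.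
  move=> lp ll; rewrite -E !fE// epseries_le ?(ltW lp) ?(ltW ll)// andbT.
  by apply: nneseries_ge0 => n *; exact/term_ge0/ltW.
apply/fine_cvgP; split.
  apply: filterS2 near_pos near_lt => l lp ll; have /andP[h1 h2] := lef l lp ll.
  by rewrite ge0_fin_numE// (le_lt_trans h2)// ltry.
apply/cvgrPdist_le => e e0.
have : (L - e)%:E < f l0 by rewrite E lte_fin ltrBlDr ltrDl.
move=> /gtf; apply: filterS3 near_pos near_lt => l lp ll.
have /andP[] := lef l lp ll; rewrite /=; case: (f l) => [y||]//=.
rewrite !lee_fin lte_fin => y0 yL Ly.
by rewrite ger0_norm; lra.
Qed.

End ereal_power_series.

(** * Scaled kernels, coefficients of the susceptibility and the critical value *)

Section susceptibility.
Context {d : measure_display} {T : measurableType d} {R : realType}.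
Variable mu : {measure set T -> \bar R}.
Variable k : T -> T -> R.
Local Open Scope ereal_scope.
Hypotheses (mu0 : 0 < mu setT) (fmu : mu setT < +oo) (K : is_kernel mu k).

Let k0 x y : (0 <= k x y)%R. Proof. by case: K. Qed.

Let mk x : measurable_fun setT (k x).
Proof. by case: K => _ _ mk _ _; exact: (measurable_fun_pair2 x mk). Qed.

Local Notation Tk := (integral_operator mu k).
Local Notation Tone := (fun n => iter n Tk (cst 1)).
Local Notation m := (fine (mu setT)).

Let m_gt0 : (0 < m)%R.
Proof. by rewrite fine_gt0// mu0 fmu. Qed.

Let mE : mu setT = m%:E.
Proof. by rewrite fineK// ge0_fin_numE. Qed.

Let Tone0 n x : 0 <= Tone n x.
Proof. by have [] := iter_Tk_ge0_measurable fmu K n. Qed.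

Let mTone n : measurable_fun setT (Tone n).
Proof. by have [] := iter_Tk_ge0_measurable fmu K n. Qed.

Lemma is_kernel_scale (l : R) : (0 <= l)%R -> is_kernel mu (scale_kernel l k).
Proof.
move=> l0; case: (K) => kk0 ksym kmeas kint kfin; split.
- by move=> x y; rewrite mulr_ge0.
- by move=> x y; rewrite /scale_kernel ksym.
- exact: measurable_funM.
- have -> : \int[mu]_x \int[mu]_y (scale_kernel l k x y)%:E = l%:E * \int[mu]_x \int[mu]_y (k x y)%:E.
    rewrite -ge0_integralZl_EFin//.
    + apply: eq_integral => x _; rewrite -ge0_integralZl_EFin//.
      * by move=> y _; rewrite lee_fin.
      * exact/measurable_EFinP.
    + by move=> x _; apply: integral_ge0 => y _; rewrite lee_fin.
    + rewrite (_ : (fun x => _) = Tk (cst 1)); first exact: (mTone 1).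
      by apply/funext => x; apply: eq_integral => y _; rewrite mule1.
  by rewrite lte_mul_pinfty.
- move=> x; have -> : \int[mu]_y (scale_kernel l k x y)%:E = l%:E * \int[mu]_y (k x y)%:E.
    rewrite -ge0_integralZl_EFin//.
    + by move=> y _; rewrite lee_fin.
    + exact/measurable_EFinP.
  by rewrite lte_mul_pinfty.
Qed.

Lemma Tk_scale (l : R) f x : (0 <= l)%R -> measurable_fun setT f -> (forall y, 0 <= f y) ->
  integral_operator mu (scale_kernel l k) f x = l%:E * Tk f x.
Proof.
move=> l0 mf f0; rewrite /integral_operator -ge0_integralZl_EFin//.
- by apply: eq_integral => y _; rewrite /scale_kernel EFinM muleA.
- by move=> y _; rewrite mule_ge0 ?lee_fin.
- by apply: emeasurable_funM => //; exact/measurable_EFinP.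
Qed.

Lemma iter_Tk_scale (l : R) n x : (0 <= l)%R ->
  iter n (integral_operator mu (scale_kernel l k)) (cst 1) x = (l ^+ n)%:E * Tone n x.
Proof.
move=> l0; elim: n x => [|n IH] x; first by rewrite /= expr0 mul1e.
rewrite iterS (_ : iter n _ _ = fun y => (l ^+ n)%:E * Tone n y); last exact/funext.
rewrite Tk_scale//.
- by rewrite (TkZ K)// ?exprn_ge0// muleA -EFinM -exprS.
- exact: measurable_funeM.
- by move=> y; rewrite mule_ge0 ?lee_fin ?exprn_ge0.
Qed.

Lemma chi_pt_scale (l : R) x : (0 <= l)%R ->
  chi_pt mu (scale_kernel l k) x = epseries (fun n => Tone n x) l.
Proof.
move=> l0; rewrite (chi_ptE fmu (is_kernel_scale l0)).
by apply: eq_eseriesr => n _; rewrite iter_Tk_scale.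
Qed.

Definition chi_coef n : \bar R := (m^-1)%:E * \int[mu]_x Tone n x.

Lemma chi_coef_ge0 n : 0 <= chi_coef n.
Proof.
by rewrite mule_ge0 ?lee_fin ?invr_ge0 ?(ltW m_gt0)// integral_ge0.
Qed.

Lemma chi_scale (l : R) : (0 <= l)%R -> chi mu (scale_kernel l k) = epseries chi_coef l.
Proof.
move=> l0; rewrite /chi /epseries.
under eq_integral do rewrite chi_pt_scale//.
rewrite integral_nneseries//; last 2 first.
- by move=> n; exact: measurable_funeM.
- by move=> n x _; rewrite mule_ge0 ?lee_fin ?exprn_ge0.
rewrite -nneseries_muleC ?lee_fin ?invr_ge0 ?(ltW m_gt0)//; last first.
  by move=> n; apply: integral_ge0 => x _; rewrite mule_ge0 ?lee_fin ?exprn_ge0.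
apply: eq_eseriesr => n _.
by rewrite ge0_integralZl_EFin ?exprn_ge0// muleCA.
Qed.

(** The inequality [l * r <= 1] is not strict, so that the critical value itself is covered, with
    [r] its inverse. *)
Lemma contraction_scale (l r : R) : (0 < l)%R -> (0 < r)%R -> (l * r <= 1)%R ->
  Tnorm mu k <= r%:E ->
  forall f : T -> R, measurable_fun setT f -> (forall x, 0 <= f x)%R ->
  \int[mu]_x (integral_operator mu (scale_kernel l k) (EFin \o f) x *
              integral_operator mu (scale_kernel l k) (EFin \o f) x) <= \int[mu]_x (f x * f x)%:E.
Proof.
move=> l0 r0 lr nr f mf f0.
have l00 := ltW l0.
have mEf : measurable_fun setT (EFin \o f) by exact/measurable_EFinP.
have T0 x : 0 <= Tk (EFin \o f) x by apply: Tk_ge0 => // y; rewrite lee_fin.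
have mT : measurable_fun setT (Tk (EFin \o f)) by exact: measurable_Tk.
have N0 : 0 <= \int[mu]_x (f x * f x)%:E.
  by apply: integral_ge0 => x _; rewrite lee_fin mulr_ge0.
under eq_integral do rewrite Tk_scale// muleACA -EFinM.
rewrite ge0_integralZl_EFin ?mulr_ge0//; last 2 first.
- by move=> x _; rewrite mule_ge0.
- exact: emeasurable_funM.
apply: (@le_trans _ _ ((l * l)%:E * ((r * r)%:E * \int[mu]_x (f x * f x)%:E))).
  by rewrite lee_wpmul2l ?lee_fin ?mulr_ge0//; exact: Tk_L2_real.
rewrite muleA -EFinM mulrACA -[leRHS]mul1e lee_wpmul2r// lee_fin.
by rewrite mulr_ile1// mulr_ge0// ltW.
Qed.

Lemma chi_pt_eq_chihat_pt (l r : R) x : (0 < l)%R -> (0 < r)%R -> (l * r <= 1)%R ->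
  Tnorm mu k <= r%:E ->
  chi_pt mu (scale_kernel l k) x = chihat_pt mu (scale_kernel l k) x.
Proof.
move=> l0 r0 lr nr.
apply: (chi_pt_chihat_pt fmu (is_kernel_scale (ltW l0))).
exact: contraction_scale nr.
Qed.

Lemma chi_eq_chihat (l r : R) : (0 < l)%R -> (0 < r)%R -> (l * r <= 1)%R ->
  Tnorm mu k <= r%:E ->
  chi mu (scale_kernel l k) = chihat mu (scale_kernel l k).
Proof.
move=> l0 r0 lr nr; congr (_ * _); apply: eq_integral => x _.
exact: chi_pt_eq_chihat_pt nr.
Qed.

Local Notation c := (fun n => fine (chi_coef n)).

Let c0 n : (0 <= c n)%R.
Proof. by rewrite fine_ge0// chi_coef_ge0. Qed.

Section bounded_norm.
Variable r : R.
Hypotheses (r0 : (0 < r)%R) (nr : Tnorm mu k <= r%:E).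

Lemma chi_coef_le n : chi_coef n <= (r ^+ n)%:E.
Proof.
apply: (@le_trans _ _ ((m^-1)%:E * ((r ^+ n)%:E * m%:E))).
  by rewrite lee_wpmul2l ?lee_fin ?invr_ge0 ?(ltW m_gt0)// -mE; exact: integral_Tone_le.
by rewrite -!EFinM lee_fin mulrCA mulVf ?mulr1// gt_eqF.
Qed.

Lemma chi_coefE n : chi_coef n = (c n)%:E.
Proof.
rewrite fineK// ge0_fin_numE ?chi_coef_ge0//.
by apply: le_lt_trans (chi_coef_le n) _; rewrite ltry.
Qed.

Lemma cvg_chi_coef (l : R) : (0 <= l)%R -> (l * r < 1)%R ->
  cvgn (series (fun n => c n * l ^+ n)%R).
Proof.
move=> l0 lr.
apply: (@series_le_cvg _ _ (geometric 1 (l * r))%R) => [n|n|n|].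
- by rewrite mulr_ge0 ?exprn_ge0.
- by rewrite /geometric/= mulr_ge0// exprn_ge0// mulr_ge0// ltW.
- rewrite /geometric/= mul1r exprMn mulrC ler_wpM2l ?exprn_ge0//.
  by rewrite -lee_fin -chi_coefE chi_coef_le.
- by apply: is_cvg_geometric_series; rewrite ger0_norm// mulr_ge0// ltW.
Qed.

Lemma epseriesE (l : R) : cvgn (series (fun n => c n * l ^+ n)%R) ->
  epseries chi_coef l = (limn (series (fun n => c n * l ^+ n)%R))%:E.
Proof.
move=> cl; rewrite /epseries; under eq_eseriesr do rewrite chi_coefE -EFinM mulrC.
exact: nneseries_EFin.
Qed.

(* [u = sum_n y^n T^n 1] satisfies [y T u + 1 = u], so it is a Schur weight. *)
Lemma Tnorm_le_of_cvg (y : R) : (0 < y)%R ->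
  cvgn (series (fun n => c n * y ^+ n)%R) -> Tnorm mu k <= (y^-1)%:E.
Proof.
move=> y0 cy; have y00 := ltW y0.
pose u x := epseries (fun n => Tone n x) y.
have t0 n x : 0 <= (y ^+ n)%:E * Tone n x by rewrite mule_ge0 ?lee_fin ?exprn_ge0.
have mt n : measurable_fun setT (fun x => (y ^+ n)%:E * Tone n x) by exact: measurable_funeM.
apply: (schur_test fmu K y0 nr r0 (u := u)).
- by apply: ge0_emeasurable_sum => // n x _ _.
- move=> x; apply: le_trans (nneseries_lim_ge 1 _); last by move=> n _ _.
  by rewrite big_nat1 expr0 mul1e.
- rewrite /u /epseries integral_nneseries//.
  have -> : \sum_(0 <= n <oo) \int[mu]_x ((y ^+ n)%:E * Tone n x) =
      m%:E * epseries chi_coef y.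
    rewrite /epseries -nneseries_muleC ?lee_fin ?(ltW m_gt0)//; last first.
      by move=> n; rewrite mule_ge0 ?chi_coef_ge0// lee_fin exprn_ge0.
    apply: eq_eseriesr => n _; rewrite ge0_integralZl_EFin ?exprn_ge0// muleCA.
    by congr (_ * _); rewrite /chi_coef muleA -EFinM mulfV ?mul1e// gt_eqF.
  by rewrite epseriesE// -EFinM ltry.
- move=> x.
  have -> : Tk u x = \sum_(0 <= n <oo) (y ^+ n)%:E * Tone n.+1 x.
    rewrite /integral_operator /u /epseries.
    transitivity (\int[mu]_z (\sum_(0 <= n <oo) (y ^+ n)%:E * ((k x z)%:E * Tone n z))).
      apply: eq_integral => z _; rewrite -nneseries_muleC ?lee_fin//.
      by apply: eq_eseriesr => n _; rewrite muleCA.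
    rewrite integral_nneseries//; last 2 first.
    - move=> n; apply: measurable_funeM; apply: emeasurable_funM => //.
      exact/measurable_EFinP.
    - by move=> n z _; rewrite !mule_ge0 ?lee_fin ?exprn_ge0.
    apply: eq_eseriesr => n _; rewrite ge0_integralZl_EFin ?exprn_ge0//.
    - by move=> z _; rewrite mule_ge0 ?lee_fin.
    - by apply: emeasurable_funM => //; exact/measurable_EFinP.
  rewrite -nneseries_muleC ?lee_fin//; last first.
    by move=> n; rewrite mule_ge0 ?lee_fin ?exprn_ge0.
  under eq_eseriesr do rewrite muleA -EFinM -exprS.
  rewrite /u /epseries [leRHS]nneseries_recl//.
  rewrite -[X in _ <= _ + X](nneseries_addn 1)//.
  under [X in _ <= _ + X]eq_eseriesr do rewrite addn1.
  by rewrite leeDr.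
Qed.

End bounded_norm.

Lemma Tnorm_ge0 : 0 <= Tnorm mu k.
Proof.
apply: le_trans (Lnorm_ge0 mu 2%:E (Top mu k (cst 0%R))) _.
apply: ereal_sup_ubound; exists (cst 0%R) => //; split => //.
rewrite Lnorm2_le//.
by rewrite integral0_eq ?lee_fin ?mulr1// => x _; rewrite mule0.
Qed.

Lemma lt_lambda_c (l : R) : (0 < l)%R -> l%:E < lambda_c mu k ->
  exists r : R, [/\ (0 < r)%R, Tnorm mu k <= r%:E & (l * r < 1)%R].
Proof.
move=> l0; rewrite /lambda_c; have := Tnorm_ge0.
case: (Tnorm mu k) => [n||]//; last first.
  by rewrite eqxx lte_fin => _ /(lt_trans l0); rewrite ltxx.
rewrite lee_fin => n0; rewrite /=.
have [->|nn0] := eqVneq n 0%R.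
  (* When the norm is 0 any positive [r] bounds it; this one gives [l * r = 1/2]. *)
  move=> _; exists (2^-1 * l^-1)%R; split.
  - by rewrite mulr_gt0 ?invr_gt0.
  - by rewrite lee_fin mulr_ge0 ?invr_ge0// ltW.
  - by rewrite mulrCA mulfV ?mulr1 ?gt_eqF// invf_lt1// ltr1n.
have np : (0 < n)%R by rewrite lt_def nn0.
rewrite eqe (negbTE nn0) lte_fin => ln; exists n; split => //.
by rewrite -ltr_pdivlMr// mul1r.
Qed.

Lemma lambda_c_EFin (l : R) : lambda_c mu k = l%:E -> (0 < l)%R -> Tnorm mu k = (l^-1)%:E.
Proof.
rewrite /lambda_c; have := Tnorm_ge0.
case: (Tnorm mu k) => [n||]//; last first.
  by rewrite eqxx => _ [<-]; rewrite ltxx.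
rewrite lee_fin => n0; rewrite /= eqe.
by case: eqVneq => // nn0 [<-] _; rewrite invrK.
Qed.

End susceptibility.

Theorem theorem5p1 (d : measure_display) (T : measurableType d) (R : realType)
    (mu : {measure set T -> \bar R}) (k : T -> T -> R) :
  type_space mu -> is_kernel mu k ->
  let lc := lambda_c mu k in
  let I := [set l : R | 0 < l /\ (l%:E < lc)%E] in
  (* chi = chihat on (0, lambda_c) *)
  (forall l, I l -> chi mu (scale_kernel l k) = chihat mu (scale_kernel l k)) /\
  (* increasing on (0, lambda_c) *)
  (forall l1 l2, I l1 -> I l2 -> l1 <= l2 ->
     (chi mu (scale_kernel l1 k) <= chi mu (scale_kernel l2 k))%E) /\
  (* finite and analytic on (0, lambda_c) *)
  (forall l, I l -> (chi mu (scale_kernel l k) < +oo)%E /\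
     analytic_at_in (fun l' => fine (chi mu (scale_kernel l' k))) I l) /\
  (* when 0 < lambda_c < oo : singularity at lambda_c and monotone limits *)
  (forall lcr : R, lc = lcr%:E -> 0 < lcr ->
     ~ analytic_at_in (fun l' => fine (chi mu (scale_kernel l' k))) I lcr /\
     chi mu (scale_kernel lcr k) = chihat mu (scale_kernel lcr k) /\
     (chi mu (scale_kernel l k) @[l --> lcr^'-] --> chi mu (scale_kernel lcr k))%E /\
     (forall x : T,
        (forall l1 l2, 0 < l1 -> l1 <= l2 -> l2 <= lcr ->
           (chi_pt mu (scale_kernel l1 k) x <= chi_pt mu (scale_kernel l2 k) x)%E) /\
        (chi_pt mu (scale_kernel l k) x @[l --> lcr^'-] --> chi_pt mu (scale_kernel lcr k) x)%E)).
Proof.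
move=> [mu0 fmu] K lc I.
pose c n := fine (chi_coef mu k n).
have chi0 := chi_coef_ge0 mu0 fmu K.
have c0 n : 0 <= c n by rewrite fine_ge0.
have Iseries l : I l -> cvgn (series (fun n => c n * l ^+ n)) /\
    chi mu (scale_kernel l k) = (limn (series (fun n => c n * l ^+ n)))%:E.
  move=> [l0 /(lt_lambda_c l0)[r [r0 nr lr]]].
  have cl := cvg_chi_coef mu0 fmu K r0 nr (ltW l0) lr.
  split; first exact: cl.
  by rewrite chi_scale ?(ltW l0)// (epseriesE mu0 fmu K r0 nr cl).
split.
  move=> l [l0 /(lt_lambda_c l0)[r [r0 nr lr]]].
  exact: (chi_eq_chihat fmu K l0 r0 (ltW lr) nr).
split.
  move=> l1 l2 [l10 _] [l20 _] l12.
  by rewrite !chi_scale ?(ltW l10) ?(ltW l20)//; apply: epseries_le => //; exact: ltW.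
split.
  move=> l Il; split; first by have [_ ->] := Iseries l Il; rewrite ltry.
  have [l0 /(lt_lambda_c l0)[r [r0 nr lr]]] := Il.
  (* Half the distance from [l] to [1 / r]: at the shifted point the product with [r] is
     [(1 + l * r) / 2 < 1]. *)
  have e0 : 0 < (1 - l * r) / (2 * r) by rewrite divr_gt0 ?subr_gt0 ?mulr_gt0.
  apply: (pseries_nneg_analytic c0 (ltW l0) e0).
    apply: (cvg_chi_coef mu0 fmu K r0 nr); first by rewrite addr_ge0 ?ltW.
    rewrite mulrDl (_ : (1 - l * r) / (2 * r) * r = (1 - l * r) / 2); first by lra.
    by field; rewrite gt_eqF.
  by move=> y /Iseries[_ ->].
move=> lcr lcE lcr0.
have nE := lambda_c_EFin lcE lcr0.
have li0 : 0 < lcr^-1 by rewrite invr_gt0.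
have nr : (Tnorm mu k <= (lcr^-1)%:E)%E by rewrite nE.
split.
  move=> /(pringsheim c0 lcr0)[].
    move=> y y0 yl; have Iy : I y by split => //; rewrite lcE lte_fin.
    by have [cy ->] := Iseries y Iy.
  move=> y ly cy; have y0 := lt_trans lcr0 ly.
  have := Tnorm_le_of_cvg mu0 fmu K li0 nr y0 cy.
  by rewrite nE lee_fin lef_pV2 ?posrE// leNgt ly.
split.
  by apply: (chi_eq_chihat fmu K lcr0 li0 _ nr); rewrite mulfV// gt_eqF.
split.
  apply: (epseries_cvg_left chi0 lcr0) => l l0.
  by rewrite chi_scale// ltW.
move=> x.
have Tone0 n : (0 <= iter n (integral_operator mu k) (cst 1) x)%E.
  by have [] := iter_Tk_ge0_measurable fmu K n.
split.
  move=> l1 l2 l10 l12 _; have l20 := lt_le_trans l10 l12.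
  by rewrite !chi_pt_scale ?(ltW l10) ?(ltW l20)//; apply: epseries_le => //; exact: ltW.
apply: (epseries_cvg_left Tone0 lcr0) => l l0.
by rewrite chi_pt_scale// ltW.
Qed.
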